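(* Let $\mathbb{X}$ be a real Banach space, let $\mathbb{Y}\subseteq\mathbb{X}$ be a linear subspace with the norm inherited from $\mathbb{X}$, and let $p$ be a seminorm on $\mathbb{X}$ for which there is a real number $P$ with $p(x)\le P\|x\|_{\mathbb{X}}$ for every $x\in\mathbb{X}$. Let $S(t)$, $t\ge 0$, be the strongly continuous linear semigroup on $\mathbb{X}$ associated with the homogeneous equation $U'(t)+\mathbb{A}U(t)=0$, and assume that there exist positive real numbers $C$ and $\delta$ such that $\|S(t)x\|_{\mathbb{X}}\le Ce^{-\delta t}\|x\|_{\mathbb{X}}$ for every $t\ge 0$ and every $x\in\mathbb{X}$. Consider the evolution equation $U'(t)+\mathbb{A}U(t)=F(t)$, and let $\operatorname{OB}_{\mathrm U}$, $\operatorname{OB}_{\mathrm G}$, $\operatorname{OB}_{\mathrm G}^{0}$, $\operatorname{OB}_{\mathrm P}$, $\operatorname{OB}_{\mathrm P}^{0}$ be the optimal bounds (depending on $\mathbb{A},\mathbb{Y},p$) defined in the context. Then $$\operatorname{OB}_{\mathrm U}(\mathbb{A},\mathbb{Y},p)=\operatorname{OB}_{\mathrm G}(\mathbb{A},\mathbb{Y},p)=\operatorname{OB}_{\mathrm G}^{0}(\mathbb{A},\mathbb{Y},p)=\operatorname{OB}_{\mathrm P}(\mathbb{A},\mathbb{Y},p)=\operatorname{OB}_{\mathrm P}^{0}(\mathbb{A},\mathbb{Y},p).$$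
   Context: Conventions. For a function $g$ defined a.e. on $(0,+\infty)$ with values in a normed space, $\limsup_{t\to+\infty}\|g(t)\|:=\lim_{T\to+\infty}\|g\|_{L^\infty((T,+\infty))}$ (essential limsup). Spaces such as $L^\infty(\mathbb{R},\mathbb{Y})$ consist of (strongly measurable) $\mathbb{X}$-valued functions in the corresponding space that take values in $\mathbb{Y}$, with norms computed in $\mathbb{X}$. Solutions for positive times. Given $F:(0,+\infty)\to\mathbb{X}$ integrable on $(0,T)$ for every $T>0$, and $U_0\in\mathbb{X}$, the mild solution of $U'+\mathbb{A}U=F$ with $U(0)=U_0$ is $$U(t)=S(t)U_0+\int_0^t S(t-\tau)F(\tau)\,d\tau\qquad\forall t\ge 0. \tag{a}$$ Globally bounded solutions. Given $F\in L^\infty(\mathbb{R},\mathbb{X})$, the unique mild solution of $U'+\mathbb{A}U=F$ that is bounded on all of $\mathbb{R}$ is $$U(t)=\int_0^{+\infty}S(\tau)F(t-\tau)\,d\tau\qquad\forall t\in\mathbb{R}, \tag{b}$$ and it is periodic if $F$ is periodic. Optimal bounds. - $\operatorname{OB}_{\mathrm U}$ is the smallest constant $K$ such that $\limsup_{t\to+\infty}p(U(t))\le K\limsup_{t\to+\infty}\|F(t)\|_{\mathbb{X}}$ for every $F\in L^1_{\mathrm{loc}}((0,+\infty),\mathbb{Y})$ (integrable on $(0,T)$ for every $T>0$) with $\limsup_{t\to+\infty}\|F(t)\|_{\mathbb{X}}<+\infty$ and every corresponding solution $U$ given by (a), with arbitrary $U_0\in\mathbb{X}$. - $\operatorname{OB}_{\mathrm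 G}$ is the smallest constant $K$ such that $\sup_{t\in\mathbb{R}}p(U(t))\le K\|F\|_{L^\infty(\mathbb{R},\mathbb{X})}$ for every $F\in L^\infty(\mathbb{R},\mathbb{Y})$, where $U$ is given by (b). - $\operatorname{OB}_{\mathrm P}$ is the smallest constant $K$ such that $\sup_{t\in\mathbb{R}}p(U(t))\le K\|F\|_{L^\infty(\mathbb{R},\mathbb{X})}$ for every periodic $F\in L^\infty(\mathbb{R},\mathbb{Y})$ (any period), where $U$ is given by (b). - $\operatorname{OB}_{\mathrm G}^{0}$ and $\operatorname{OB}_{\mathrm P}^{0}$ are defined as $\operatorname{OB}_{\mathrm G}$ and $\operatorname{OB}_{\mathrm P}$ respectively, but with the inequality $p(U(0))\le K\|F\|_{L^\infty(\mathbb{R},\mathbb{X})}$ in place of the one with the supremum over $t$. *)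

(* Defs.v *)
From HB Require Import structures.
From mathcomp Require Import all_boot all_order all_algebra.
From mathcomp Require Import all_classical all_reals all_analysis.

Set Implicit Arguments.
Unset Strict Implicit.
Unset Printing Implicit Defensive.

Import Order.TTheory GRing.Theory Num.Theory.
Import numFieldNormedType.Exports.

Local Open Scope classical_set_scope.
Local Open Scope ring_scope.

(* MathComp-Analysis has no integral for functions with values in a Banach
   space: the Bochner integral is defined here. *)

Section bochner.
Context d (T : measurableType d) (R : realType).
Variables (mu : {measure set T -> \bar R}) (X : normedModType R).
Implicit Types (D : set T) (f s : T -> X).

Definition simple_function s : Prop :=
  finite_set (range s) /\ forall x, measurable (s @^-1` [set x]).

Definition integrable_simple_function D s : Prop :=
  simple_function s /\
  forall x, x != 0 -> (mu (D `&` s @^-1` [set x]) < +oo)%E.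

(* [fine] sends [+oo] to [0], which only matters for the value [x = 0]. *)
Definition simple_integral D s : X :=
  \sum_(x \in range s) fine (mu (D `&` s @^-1` [set x])) *: x.

Definition ae_cvg D (s_ : nat -> T -> X) f : Prop :=
  {ae mu, forall t, D t -> s_ n t @[n --> \oo] --> f t}.

Definition strongly_measurable D f : Prop :=
  exists2 s_ : nat -> T -> X,
    (forall n, simple_function (s_ n)) & ae_cvg D s_ f.

Definition bochner_approximation D f (s_ : nat -> T -> X) : Prop :=
  [/\ forall n, integrable_simple_function D (s_ n),
      ae_cvg D s_ f &
      (\int[mu]_(t in D) `|f t - s_ n t|%:E)%E @[n --> \oo] --> 0%E].

Definition bochner_integrable D f : Prop :=
  exists s_ : nat -> T -> X, bochner_approximation D f s_.

Definition is_bochner_integral D f (v : X) : Prop :=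
  exists2 s_ : nat -> T -> X, bochner_approximation D f s_ &
    simple_integral D (s_ n) @[n --> \oo] --> v.

(* Junk value [0] when [f] is not Bochner integrable on [D]. *)
Definition bochner_integral D f : X := xget 0 (is_bochner_integral D f).

End bochner.

(* Functions "defined a.e." are represented by total functions on [R]; all
   the conditions on them are insensitive to modifications on null sets. *)

Section essential_bounds.
Context (R : realType) (V : normedModType R).
Implicit Types (D : set R) (g : R -> V).

Definition Linfty_norm D g : \bar R :=
  Lnorm (@lebesgue_measure R) +oo%E ((fun t => `|g t|%:E) \_ D).

Definition ess_limsup g : \bar R :=
  lim (Linfty_norm `]T, +oo[ g @[T --> +oo%R]).

End essential_bounds.

Section semigroups.
Context (R : realType) (X : normedModType R).

Definition seminorm (p : X -> R) : Prop :=
  (forall x y, p (x + y) <= p x + p y) /\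
  (forall (a : R) x, p (a *: x) = `|a| * p x).

(* Only the values [S t] with [0 <= t] are relevant. *)
Definition strongly_continuous_semigroup (S : R -> X -> X) : Prop :=
  [/\ forall t, 0 <= t -> linear (S t) /\ continuous (S t),
      forall x, S 0 x = x,
      forall s t x, 0 <= s -> 0 <= t -> S (s + t) x = S s (S t x) &
      forall x, {within `[0, +oo[, continuous (fun t => S t x)}].

(* The unbounded operator [G] with domain [domG] is the infinitesimal
   generator of [S]; [G] is irrelevant outside [domG]. *)
Definition generator (S : R -> X -> X) (domG : set X) (G : X -> X) : Prop :=
  domG = [set x | cvg (h^-1 *: (S h x - x) @[h --> 0^'+])] /\
  forall x, domG x -> h^-1 *: (S h x - x) @[h --> 0^'+] --> G x.

(* [S] is the semigroup of [U' + A U = 0], that is, generated by [- A]. *)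
Definition associated_semigroup (domA : set X) (A : X -> X)
    (S : R -> X -> X) : Prop :=
  strongly_continuous_semigroup S /\ generator S domA (fun x => - A x).

End semigroups.

Section optimal_bounds.
Context (R : realType) (X : completeNormedModType R).
Variables (S : R -> X -> X) (Y : submodClosed X) (p : X -> R).
Local Notation mu := (@lebesgue_measure R).
Implicit Types (F : R -> X) (K : R).

Definition mild_solution F (U0 : X) (t : R) : X :=
  S t U0 + bochner_integral mu `]0, t[ (fun tau => S (t - tau) (F tau)).

Definition global_solution F (t : R) : X :=
  bochner_integral mu `]0, +oo[ (fun tau => S tau (F (t - tau))).

Definition L1loc_in F : Prop :=
  (forall T, 0 < T -> bochner_integrable mu `]0, T[ F) /\
  {ae mu, forall t, 0 < t -> F t \in Y}.

Definition Linfty_in F : Prop :=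
  [/\ strongly_measurable mu setT F,
      (Linfty_norm setT F < +oo)%E &
      {ae mu, forall t, F t \in Y}].

Definition ae_periodic F : Prop :=
  exists2 T, 0 < T & {ae mu, forall t, F (t + T) = F t}.

(* Constants are nonnegative: if [Y] is trivial, then every real [K] satisfies
   the inequalities below, and the optimal bound is meant to be [0]. *)

Definition bound_U K : Prop := 0 <= K /\
  forall F U0, L1loc_in F -> (ess_limsup F < +oo)%E ->
    (ess_limsup (fun t => p (mild_solution F U0 t)) <= K%:E * ess_limsup F)%E.

Definition bound_G K : Prop := 0 <= K /\
  forall F, Linfty_in F ->
    (ereal_sup [set (p (global_solution F t))%:E | t in [set: R]]
       <= K%:E * Linfty_norm setT F)%E.

Definition bound_G0 K : Prop := 0 <= K /\
  forall F, Linfty_in F ->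
    ((p (global_solution F 0))%:E <= K%:E * Linfty_norm setT F)%E.

Definition bound_P K : Prop := 0 <= K /\
  forall F, Linfty_in F -> ae_periodic F ->
    (ereal_sup [set (p (global_solution F t))%:E | t in [set: R]]
       <= K%:E * Linfty_norm setT F)%E.

Definition bound_P0 K : Prop := 0 <= K /\
  forall F, Linfty_in F -> ae_periodic F ->
    ((p (global_solution F 0))%:E <= K%:E * Linfty_norm setT F)%E.

Definition smallest (B : R -> Prop) K : Prop :=
  B K /\ forall K', B K' -> K <= K'.

Definition is_OB_U := smallest bound_U.
Definition is_OB_G := smallest bound_G.
Definition is_OB_G0 := smallest bound_G0.
Definition is_OB_P := smallest bound_P.
Definition is_OB_P0 := smallest bound_P0.

End optimal_bounds.

(* Main.v *)
(* All five families of admissible constants coincide; the optimal bound is the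
   infimum of the constants admissible at time 0, where the inequality is
   closed in K.  Translation in time passes from t = 0 to every t.  The
   variation of constants formula
     U(t) = S(t - a) U(a) + int_a^t S(t - tau) F(tau) dtau
   does the rest, its first term being exponentially small.  A solution for
   positive times differs by such a term from the bounded solution with
   forcing F restricted to (T, t), which gives the bound for U from G.
   Conversely, the bounded solution of a periodic F is itself periodic and is a
   mild solution for positive times, so the limsup bound controls it almost
   everywhere, and by right continuity at t = 0.  Finally, replacing F by the
   q-periodic function equal to F on (-q, 0) changes U(0) by a term of order
   exp (- delta q). *)
Require Import Defs.
From HB Require Import structures.
From mathcomp Require Import all_boot all_order all_algebra finmap lra ring.
From mathcomp Require Import all_classical all_reals all_analysis.
From mathcomp Require Import measurable_realfun ess_sup_inf.

Set Implicit Arguments.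
Unset Strict Implicit.
Unset Printing Implicit Defensive.

Import Order.TTheory GRing.Theory Num.Theory.
Import numFieldNormedType.Exports.

Local Open Scope classical_set_scope.
Local Open Scope ring_scope.

(** The essential limsup sees only the far future, so a constant admissible for U says nothing
    directly about a given bounded solution at time 0. Periodicity carries the value at 0 to
    arbitrarily late times, which is why the periodic bounds mediate between U and G. The analytic
    obstacle is measurability. A strongly measurable [f] is only an a.e. limit of simple functions,
    so [|f - s|] need not be measurable. Estimates therefore rest on the integral as a supremum over
    simple functions, which is monotone for arbitrary nonnegative functions, and pass to a
    measurable representative wherever additivity or scaling is required. Integrals over a domain
    become integrals over the whole space by extending the integrand by 0. Both solution formulas
    then take the single form [conv D F t], and one splitting lemma yields the variation of
    constants formula for each of them. *)

Section almost_everywhere.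
Context d (T : measurableType d) (R : realType) (mu : {measure set T -> \bar R}).
Implicit Types P Q : T -> Prop.

(* For the Lebesgue measure, [Filter (almost_everywhere mu)] is not found by
   instance resolution; this lemma hides the instance. *)
Lemma ae_imply P Q : {ae mu, forall t, P t} -> (forall t, P t -> Q t) ->
  {ae mu, forall t, Q t}.
Proof. by move=> mP PQ; exact: filterS mP. Qed.

End almost_everywhere.

(** * Almost everywhere comparison of integrals without measurability *)

Section lower_integral.
Context d (T : measurableType d) (R : realType).
Variable mu : {measure set T -> \bar R}.
Local Open Scope ereal_scope.

Import HBNNSimple.

(* The integral of a nonnegative function is a supremum over the simple
   functions below it, hence monotone even without measurability. *)
Lemma ge0_ae_le_lower_integral (f g : T -> \bar R) :
  (forall x, 0 <= f x) -> (forall x, 0 <= g x) ->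
  {ae mu, forall x, f x <= g x} ->
  \int[mu]_x f x <= \int[mu]_x g x.
Proof.
move=> f0 g0 [N [mN muN fgN]].
rewrite ge0_integralTE//; apply: ge_ereal_sup => _ [h /= hf <-].
rewrite -integralT_nnsfun.
(* Setting [h] to 0 on the null set [N] keeps its integral and turns the a.e. bound by [g] into a
   bound everywhere. *)
pose h' := mul_nnsfun h (indic_nnsfun R (measurableC mN)).
have -> : \int[mu]_x (h x)%:E = \int[mu]_x (h' x)%:E.
  apply: ge0_ae_eq_integral => //.
  - by apply/measurable_EFinP; exact: measurable_funP.
  - by apply/measurable_EFinP; exact: measurable_funP.
  - by move=> x _; rewrite lee_fin.
  - by move=> x _; rewrite lee_fin.
  exists N; split => //= x /= hx; apply: contrapT => Nx; apply: hx => _.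
  by rewrite /= mindicE mem_set// mulr1.
rewrite integralT_nnsfun ge0_integralTE//; apply: ereal_sup_ubound.
exists h' => // x /=; rewrite mindicE.
have [xN|xN] := pselect (N x); first by rewrite memNset ?mulr0//; exact: (@^~ xN).
rewrite mem_set// mulr1 (le_trans (hf x))//.
by apply: contrapT => H; apply: xN; apply: fgN.
Qed.

Lemma ge0_ae_eq_lower_integral (f g : T -> \bar R) :
  (forall x, 0 <= f x) -> (forall x, 0 <= g x) ->
  {ae mu, forall x, f x = g x} ->
  \int[mu]_x f x = \int[mu]_x g x.
Proof.
move=> f0 g0 fg; apply/eqP; rewrite eq_le !ge0_ae_le_lower_integral//.
  by apply: filterS fg => x ->.
by apply: filterS fg => x ->.
Qed.

End lower_integral.

(** * Functions with finite range and measurable fibres *)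

Section finite_range.
Context d (T : measurableType d).

(* For [A : normedModType R] this is convertible to [simple_function]. *)
Definition fsimple (A : Type) (s : T -> A) : Prop :=
  finite_set (range s) /\ forall x, measurable (s @^-1` [set x]).

(** The type [A] carries no sigma-algebra: every preimage, of whatever set, is a finite union of
    measurable fibres. *)
Lemma fsimple_preimage (A : choiceType) (s : T -> A) (P : set A) :
  fsimple s -> measurable (s @^-1` P).
Proof.
move=> [fs ms].
have -> : s @^-1` P = \bigcup_(x in range s `&` P) s @^-1` [set x].
  apply/seteqP; split => t /=; first by move=> Pt; exists (s t) => //; split=> //; exists t.
  by move=> [x [_ Px] /= ->].
by apply: fin_bigcup_measurable => //; exact: finite_setIl.
Qed.

Lemma fsimple_comp (A B : choiceType) (g : A -> B) (s : T -> A) :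
  fsimple s -> fsimple (g \o s).
Proof.
move=> fs; split; last by move=> x; exact: (fsimple_preimage (g @^-1` [set x]) fs).
by case: fs => fs _; rewrite -(image_comp s g); exact: finite_image.
Qed.

Lemma fsimple_pair (A B : choiceType) (s : T -> A) (r : T -> B) :
  fsimple s -> fsimple r -> fsimple (fun t => (s t, r t)).
Proof.
move=> [fs ms] [fr mr]; split.
  apply: (@sub_finite_set _ _ (range s `*` range r)); last exact: finite_setX.
  by move=> _ [t _ <-]; split; exists t.
move=> [x y]; rewrite [X in measurable X](_ : _ =
  s @^-1` [set x] `&` r @^-1` [set y]); last first.
  by apply/seteqP; split => t /=; [case=> -> ->|case=> -> ->].
exact: measurableI.
Qed.

Lemma fsimple_mem (D : set T) : measurable D -> fsimple (fun t => t \in D).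
Proof.
move=> mD; split; first exact: finite_finset.
move=> [].
  rewrite [X in measurable X](_ : _ = D)//; apply/seteqP; split => t /=.
    by move=> tD; exact: set_mem.
  by move/mem_set.
rewrite [X in measurable X](_ : _ = ~` D); first exact: measurableC.
apply/seteqP; split => t /=; first by move=> tD /mem_set; rewrite tD.
exact: memNset.
Qed.

Lemma fsimple_cst (A : choiceType) (a : A) : fsimple (fun=> a).
Proof. exact: (fsimple_comp (fun=> a) (fsimple_mem measurableT)). Qed.

Lemma fsimple_measurable (R : realType) (A : choiceType) (s : T -> A) (g : A -> R) :
  fsimple s -> measurable_fun setT (g \o s).
Proof.
move=> fs _ B mB; rewrite setTI.
exact: (fsimple_preimage (g @^-1` B) fs).
Qed.

End finite_range.

(** * The integral of simple functions *)

Section bochner_theory.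
Context d (T : measurableType d) (R : realType).
Variables (mu : {measure set T -> \bar R}) (X : completeNormedModType R).
Implicit Types (f g s r : T -> X) (D : set T).

Lemma simple_integral_sum D s (A : set X) :
  simple_function s -> finite_set A -> range s `<=` A ->
  simple_integral mu D s =
    \sum_(x <- fset_set A) fine (mu (D `&` s @^-1` [set x])) *: x.
Proof.
move=> ss fA sA; rewrite /simple_integral (fsbig_widen _ A)//; first exact: fsbig_finite.
move=> x /= [_ nx]; rewrite [X in mu X](_ : _ = set0) ?measure0 ?scale0r//.
by apply/seteqP; split => // t /= [_ sx]; apply: nx; exists t.
Qed.

Lemma measure_preimage_sum (A : choiceType) (k : T -> A) (P : pred A) :
  fsimple k -> mu (k @^-1` [set a | P a]) =
    (\sum_(a <- fset_set (range k) | P a) mu (k @^-1` [set a]))%E.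
Proof.
move=> fk; have fin : finite_set (range k `&` [set a | P a]).
  by apply: finite_setIl; case: fk.
rewrite [X in mu X](_ : _ = \bigcup_(a in range k `&` [set a | P a]) k @^-1` [set a]);
  last first.
  apply/seteqP; split => t /=.
    by move=> Pt; exists (k t) => //; split => //; exists t.
  by move=> [a [_ Pa] /= ->].
rewrite measure_fin_bigcup//; last 2 first.
  by move=> a b _ _ [t [/= -> ->]].
  by move=> a _; case: fk.
rewrite fsbig_finite//= -[RHS]big_filter; apply: perm_big.
apply: uniq_perm; [exact: fset_uniq|exact/filter_uniq/fset_uniq|].
move=> a; rewrite mem_filter in_fset_set// in_fset_set; last by case: fk.
by rewrite in_setI andbC; congr (_ && _); apply/idP/idP; rewrite inE.
Qed.

(* Lets both integrands of a binary operation be summed over one partition. *)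
Lemma simple_integral_factor (A : choiceType) (k : T -> A) (g : A -> X) :
  fsimple k ->
  (forall a, g a != 0 -> (mu (k @^-1` [set a]) < +oo)%E) ->
  simple_integral mu setT (g \o k) =
    \sum_(a <- fset_set (range k)) fine (mu (k @^-1` [set a])) *: g a.
Proof.
move=> fk gfin; have sgk : simple_function (g \o k) by exact: fsimple_comp.
rewrite (simple_integral_sum _ sgk (proj1 sgk))//.
under eq_bigr do rewrite setTI.
transitivity (\sum_(x <- fset_set (range (g \o k)))
   \sum_(a <- fset_set (range k)) if g a == x then fine (mu (k @^-1` [set a])) *: x else 0).
  (* The fibre over 0 may have infinite measure, where [fine] is not additive; the factor [x = 0]
     removes it from both sides. *)
  apply: eq_bigr => x _; have [->|x0] := eqVneq x 0.
    by rewrite scaler0 big1// => a _; rewrite scaler0 if_same.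
  rewrite -big_mkcond/= -scaler_suml; congr (_ *: _).
  rewrite (_ : _ @^-1` _ = k @^-1` [set a | g a == x]); last first.
    by apply/seteqP; split => t /= /eqP.
  rewrite (measure_preimage_sum (fun a => g a == x) fk) -sum_fine//.
  move=> a /eqP ga; rewrite ge0_fin_numE//; apply: gfin.
  by rewrite ga.
rewrite exchange_big/= big_seq [RHS]big_seq; apply: eq_bigr => a ak.
rewrite -big_mkcond/= (eq_bigl (pred1 (g a))); last by move=> x /=; rewrite eq_sym.
rewrite -big_filter filter_pred1_uniq ?big_seq1 ?fset_uniq//.
rewrite in_fset_set; last by case: sgk.
by move: ak; rewrite in_fset_set ?inE; [move=> [t _ <-]; exists t|case: fk].
Qed.

Lemma simple_integralD s r :
  integrable_simple_function mu setT s -> integrable_simple_function mu setT r ->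
  simple_integral mu setT (s \+ r) = simple_integral mu setT s + simple_integral mu setT r.
Proof.
move=> [ss sfin] [sr rfin].
have fk : fsimple (fun t => (s t, r t)) by exact: fsimple_pair.
have fin1 (a : X * X) : a.1 != 0 -> (mu ((fun t => (s t, r t)) @^-1` [set a]) < +oo)%E.
  move=> /sfin; rewrite setTI; apply: le_lt_trans; apply: le_measure.
  - by rewrite inE; case: fk.
  - by rewrite inE; case: ss.
  - by move=> t /= <-.
have fin2 (a : X * X) : a.2 != 0 -> (mu ((fun t => (s t, r t)) @^-1` [set a]) < +oo)%E.
  move=> /rfin; rewrite setTI; apply: le_lt_trans; apply: le_measure.
  - by rewrite inE; case: fk.
  - by rewrite inE; case: sr.
  - by move=> t /= <-.
rewrite -[s \+ r]/((fun a => a.1 + a.2) \o (fun t => (s t, r t))).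
rewrite simple_integral_factor//; last first.
  move=> a; have [a1|a1 _] := eqVneq a.1 0; last exact: fin1.
  by rewrite a1 add0r => /fin2.
rewrite -[X in _ = simple_integral _ _ X + _]/(fst \o (fun t => (s t, r t))).
rewrite -[X in _ = _ + simple_integral _ _ X]/(snd \o (fun t => (s t, r t))).
rewrite !simple_integral_factor// -big_split/=; apply: eq_bigr => a _.
by rewrite scalerDr.
Qed.

Lemma integrable_simple_comp (g : X -> X) s :
  g 0 = 0 -> integrable_simple_function mu setT s ->
  integrable_simple_function mu setT (g \o s).
Proof.
move=> g0 [ss sfin]; have sgs : fsimple (g \o s) by exact: fsimple_comp.
split=> // x x0; rewrite setTI.
rewrite (_ : _ @^-1` _ = s @^-1` [set a | g a == x]); last first.
  by apply/seteqP; split => t /= /eqP.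
rewrite (measure_preimage_sum (fun a => g a == x) ss).
apply: lte_sum_pinfty => a /eqP ga; rewrite -[X in mu X]setTI; apply: sfin.
by apply: contra_neq x0 => a0; rewrite -ga a0.
Qed.

Lemma integrable_simpleD s r :
  integrable_simple_function mu setT s -> integrable_simple_function mu setT r ->
  integrable_simple_function mu setT (s \+ r).
Proof.
move=> [ss sfin] [sr rfin].
have sD : fsimple (s \+ r).
  by rewrite -[s \+ r]/((fun a => a.1 + a.2) \o (fun t => (s t, r t)));
    apply: fsimple_comp; exact: fsimple_pair.
pose nz := [set a : X | a != 0].
have supp (q : T -> X) : integrable_simple_function mu setT q ->
    (mu (q @^-1` nz) < +oo)%E.
  move=> [sq qfin]; rewrite (measure_preimage_sum (fun a => a != 0) sq).
  by apply: lte_sum_pinfty => a /qfin; rewrite setTI.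
split=> // x x0; rewrite setTI.
have mN (q : T -> X) : fsimple q -> measurable (q @^-1` nz).
  exact: fsimple_preimage.
apply: (@le_lt_trans _ _ (mu (s @^-1` nz `|` r @^-1` nz))).
  apply: le_measure; rewrite ?inE//.
  - by case: sD.
  - by apply: measurableU; exact: mN.
  - move=> t /= srx; have [st0|] := eqVneq (s t) 0; last by left.
    by right; apply: contra_neq x0 => rt0; rewrite -srx st0 rt0 addr0.
apply: le_lt_trans; first by apply: measureU2; exact: mN.
by rewrite lte_add_pinfty//; exact: supp.
Qed.

Lemma simple_integral_linear (L : X -> X) s :
  L 0 = 0 -> {morph L : x y / x + y} -> (forall a x, L (a *: x) = a *: L x) ->
  integrable_simple_function mu setT s ->
  simple_integral mu setT (L \o s) = L (simple_integral mu setT s).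
Proof.
move=> L0 LD LZ [ss sfin].
have sE : simple_integral mu setT s = simple_integral mu setT (id \o s) by [].
have fin x : x != 0 -> (mu (s @^-1` [set x]) < +oo)%E.
  by move=> /sfin; rewrite setTI.
rewrite sE !simple_integral_factor//; last first.
  by move=> a La; apply: fin; apply: contra_neq La => ->.
rewrite (big_morph L LD L0); apply: eq_bigr => a _.
by rewrite LZ.
Qed.

Lemma integral_norm_simple s : simple_function s ->
  (\int[mu]_t `|s t|%:E =
    \sum_(x <- fset_set (range s)) `|x|%:E * mu (s @^-1` [set x]))%E.
Proof.
move=> ss; have fs := proj1 ss.
have -> : (fun t => `|s t|%:E) =
   (fun t => \sum_(x <- fset_set (range s)) (`|x| * \1_(s @^-1` [set x]) t)%:E)%E.
  apply/funext => t; rewrite sumEFin; congr EFin.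
  rewrite (bigD1_seq (s t))/=; [|by rewrite in_fset_set// inE; exists t|exact: fset_uniq].
  rewrite indicE mem_set// mulr1 big1 ?addr0// => x xs.
  rewrite indicE memNset ?mulr0// => /= sx.
  by move: xs; rewrite -sx eqxx.
have ms x : measurable (s @^-1` [set x]) by exact: (proj2 ss).
rewrite ge0_integral_sum//; last first.
  by move=> x; apply/measurable_EFinP; exact: measurable_funM.
apply: eq_bigr => x _; under eq_integral do rewrite EFinM.
rewrite ge0_integralZl//; first by rewrite integral_indic// setIT.
exact/measurable_EFinP.
Qed.

Lemma norm_simple_integral_le s : integrable_simple_function mu setT s ->
  (`|simple_integral mu setT s|%:E <= \int[mu]_t `|s t|%:E)%E.
Proof.
move=> [ss sfin]; rewrite (simple_integral_sum _ ss (proj1 ss))// integral_norm_simple//.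
rewrite (le_trans (y := (\sum_(x <- fset_set (range s))
   `|fine (mu (setT `&` s @^-1` [set x])) *: x|)%:E))//.
  by rewrite lee_fin ler_norm_sum.
rewrite -sumEFin; apply: lee_sum => x _; rewrite setTI normrZ.
have [->|x0] := eqVneq x 0; first by rewrite normr0 mulr0 mul0e.
rewrite ger0_norm ?fine_ge0// EFinM fineK 1?muleC//.
by rewrite ge0_fin_numE//; have := sfin _ x0; rewrite setTI.
Qed.

End bochner_theory.

(* The library's restriction [f \_ D] takes the value [point] outside [D], and
   [point] need not be [0] in an abstract normed module. *)
Definition zext (T : Type) (V : zmodType) (D : set T) (f : T -> V) (t : T) : V :=
  if t \in D then f t else 0.

(** * Uniqueness, existence and norm bound of the Bochner integral *)

Section bochner_integral_theory.
Context d (T : measurableType d) (R : realType).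
Variables (mu : {measure set T -> \bar R}) (X : completeNormedModType R).
Implicit Types (f g s r : T -> X) (D : set T) (v w : X).

Local Notation approx := (bochner_approximation mu setT).
Local Notation bint := (is_bochner_integral mu setT).
Local Notation sint := (simple_integral mu setT).

Lemma cvg0_of_norm_le (V : normedModType R) (u : nat -> V) (e : nat -> \bar R) :
  (forall n, (`|u n|%:E <= e n)%E) -> e n @[n --> \oo] --> 0%E ->
  u n @[n --> \oo] --> (0 : V).
Proof.
move=> ue e0; apply/norm_cvg0P.
suff /fine_cvgP[] : (`|u n|%:E)%E @[n --> \oo] --> 0%:E by [].
apply: (@squeeze_cvge _ _ _ _ (fun=> 0%E) _ e); last exact: e0.
  by apply: nearW => n; rewrite ue andbT lee_fin.
exact: cvg_cst.
Qed.

Lemma strongly_measurableP f : strongly_measurable mu setT f <->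
  exists2 s_ : nat -> T -> X, (forall n, fsimple (s_ n)) &
    {ae mu, forall t, s_ n t @[n --> \oo] --> f t}.
Proof.
split=> -[s_ ss sf]; exists s_ => //; apply: filterS sf => t /=; first exact.
by move=> h _.
Qed.

(** The measure is not assumed complete, so [|f - s|] itself may fail to be measurable. Setting it
    to 0 on the exceptional null set makes it an everywhere limit of measurable functions. *)
Lemma strongly_measurable_distE f s : strongly_measurable mu setT f -> fsimple s ->
  exists2 m : T -> R, measurable_fun setT m &
    (forall t, 0 <= m t) /\ {ae mu, forall t, `|f t - s t| = m t}.
Proof.
move=> /strongly_measurableP[s_ ss [N [mN N0 sN]]] fs.
have fN := fsimple_mem (measurableC mN).
have H t : ~ N t -> s_ n t @[n --> \oo] --> f t.
  by move=> Nt; apply: contrapT => h; apply: Nt; exact: sN.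
exists (fun t => if t \in ~` N then `|f t - s t| else 0).
  apply: (@measurable_fun_cvg _ _ _ _
    (fun n t => if t \in ~` N then `|s_ n t - s t| else 0)).
    move=> n.
    exact: (fsimple_measurable
      (fun a : bool * (X * X) => if a.1 then `|a.2.1 - a.2.2| else 0)
      (fsimple_pair fN (fsimple_pair (ss n) fs))).
  move=> t _; case: ifPn => [/set_mem /H st|_]; last exact: cvg_cst.
  by apply: cvg_norm; apply: cvgB => //; exact: cvg_cst.
split; first by move=> t; case: ifP.
exists N; split => // t /= h; apply: contrapT => Nt; apply: h.
by rewrite mem_set.
Qed.

Lemma approx_strongly_measurable f (s_ : nat -> T -> X) : approx f s_ -> strongly_measurable mu setT f.
Proof. by move=> [ss sf _]; exists s_ => // n; case: (ss n). Qed.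

(** For nonmeasurable functions the supremum over simple functions is not additive; the measurable
    representatives [m] and [n] restore additivity. *)
Lemma ge0_ae_integralD (f g m n : T -> R) :
  measurable_fun setT m -> measurable_fun setT n ->
  (forall t, 0 <= f t) -> (forall t, 0 <= g t) ->
  (forall t, 0 <= m t) -> (forall t, 0 <= n t) ->
  {ae mu, forall t, f t = m t} -> {ae mu, forall t, g t = n t} ->
  (\int[mu]_t (f t + g t)%:E = \int[mu]_t (f t)%:E + \int[mu]_t (g t)%:E)%E.
Proof.
move=> mm mn f0 g0 m0 n0 fm gn.
have eqi (h k : T -> R) : (forall t, 0 <= h t) -> (forall t, 0 <= k t) ->
    {ae mu, forall t, h t = k t} -> (\int[mu]_t (h t)%:E = \int[mu]_t (k t)%:E)%E.
  move=> h0 k0 hk; apply: ge0_ae_eq_lower_integral => [t|t|]; rewrite ?lee_fin//.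
  by apply: filterS hk => t ->.
rewrite (eqi f m)// (eqi g n)// (eqi (f \+ g) (m \+ n)); first last.
- by apply: filterS2 fm gn => t /= -> ->.
- by move=> t; rewrite addr_ge0.
- by move=> t; rewrite addr_ge0.
under eq_integral do rewrite EFinD.
by rewrite ge0_integralD//; [move=> t _; rewrite lee_fin|exact/measurable_EFinP
  |move=> t _; rewrite lee_fin|exact/measurable_EFinP].
Qed.

(** The estimate behind the whole theory: with [r] from another approximation it gives uniqueness of
    the integral, with [r] from the same sequence the Cauchy property, with [r = 0] the norm
    bound. *)
Lemma simple_integral_dist f s r : strongly_measurable mu setT f ->
  integrable_simple_function mu setT s -> integrable_simple_function mu setT r ->
  (`|sint s - sint r|%:E <=
    \int[mu]_t `|f t - s t|%:E + \int[mu]_t `|f t - r t|%:E)%E.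
Proof.
move=> sf is_ ir.
have iNr : integrable_simple_function mu setT (-%R \o r).
  by apply: integrable_simple_comp => //; exact: oppr0.
have -> : sint s - sint r = sint (s \+ (-%R \o r)).
  rewrite simple_integralD// simple_integral_linear//.
  - exact: oppr0.
  - exact: opprD.
  - by move=> a x; rewrite scalerN.
have [m mm [m0 fm]] := strongly_measurable_distE sf (proj1 is_).
have [n mn [n0 fn]] := strongly_measurable_distE sf (proj1 ir).
apply: (le_trans (norm_simple_integral_le (integrable_simpleD is_ iNr))).
rewrite -(ge0_ae_integralD mm mn _ _ m0 n0 fm fn)//.
apply: ge0_ae_le_lower_integral.
- by move=> t; rewrite lee_fin.
- by move=> t; rewrite lee_fin addr_ge0.
- apply: aeW => t; rewrite lee_fin /=.
  have -> : s t - r t = (f t - r t) - (f t - s t) by rewrite opprB [RHS]addrC addrA subrK.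
  by rewrite [leRHS]addrC ler_normB.
Qed.

Lemma approx_simple_integral_cvg f (s_ r_ : nat -> T -> X) v : approx f s_ -> approx f r_ ->
  sint (s_ n) @[n --> \oo] --> v -> sint (r_ n) @[n --> \oo] --> v.
Proof.
move=> as_ ar sv; have sm := approx_strongly_measurable as_.
case: as_ ar => [is_ _ es] [ir _ er].
have : sint (r_ n) - sint (s_ n) @[n --> \oo] --> (0 : X).
  apply: cvg0_of_norm_le; first by move=> n; exact: (simple_integral_dist sm (ir n) (is_ n)).
  by rewrite -[X in _ --> X]adde0; apply: cvgeD.
move=> /cvgD => /(_ _ _ sv); rewrite add0r; apply: cvg_trans.
by apply: near_eq_cvg; apply: nearW => n /=; rewrite subrK.
Qed.

Lemma bint_unique f v w : bint f v -> bint f w -> v = w.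
Proof.
move=> [s_ as_ sv] [r_ ar rw].
by have /(cvg_unique _ rw) -> := approx_simple_integral_cvg as_ ar sv.
Qed.

Lemma bochner_integralE f v : bint f v -> bochner_integral mu setT f = v.
Proof.
by move=> fv; apply: (bint_unique _ fv); apply: xgetPex; exists v.
Qed.

(** Completeness of [X] enters here: the integrals of the approximants form a Cauchy sequence by
    [simple_integral_dist]. *)
Lemma bochner_integrableP f : bochner_integrable mu setT f <-> exists v, bint f v.
Proof.
split=> [[s_ as_]|[v [s_ as_ _]]]; last by exists s_.
have sm := approx_strongly_measurable as_; have [is_ _ es] := as_.
suff /cvg_ex[v sv] : cvg (sint (s_ n) @[n --> \oo]) by exists v, s_.
apply: cauchy_cvg; apply/cauchyP => e e0.
move/fine_cvgP: (es) => [[k0 _ fin_k] /cvgrPdist_lt /(_ (e / 2)) [|k _ small]].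
  exact: divr_gt0.
exists (sint (s_ (maxn k0 k))).
rewrite -ball_normE; exists (maxn k0 k) => // n /= nk.
have hb j : (maxn k0 k <= j)%N -> (\int[mu]_t `|f t - s_ j t|%:E < (e / 2)%:E)%E.
  rewrite geq_max => /andP[k0j kj].
  rewrite -(fineK (fin_k _ k0j)) lte_fin.
  by have := small _ kj; rewrite sub0r normrN; apply: le_lt_trans; exact: ler_norm.
rewrite -lte_fin (le_lt_trans (simple_integral_dist sm (is_ _) (is_ _)))//.
rewrite (splitr e) EFinD lteD//; exact: hb.
Qed.

Lemma bint_ae_eq f g v : {ae mu, forall t, f t = g t} -> bint f v -> bint g v.
Proof.
move=> fg [s_ [is_ sf es] sv]; exists s_ => //; split => //.
  by apply: filterS2 fg sf => t ->.
apply: cvg_trans es; apply: near_eq_cvg; apply: nearW => n /=.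
apply: ge0_ae_eq_lower_integral => [t|t|].
- by rewrite lee_fin.
- by rewrite lee_fin.
- by apply: filterS fg => t ->.
Qed.

Lemma bint_norm_le f v : bint f v -> (`|v|%:E <= \int[mu]_t `|f t|%:E)%E.
Proof.
move=> [s_ as_ sv]; have sm := approx_strongly_measurable as_.
case: as_ => [is_ sf es].
(* Comparison with the zero function bounds each simple integral by the integral of [|f|] plus the
   approximation error, which then tends to 0. *)
pose z : T -> X := fun=> 0.
have s0 : integrable_simple_function mu setT z.
  have fs0 : fsimple z by exact: fsimple_cst.
  split => // x x0; rewrite (_ : _ `&` _ = set0) ?measure0// setTI.
  by apply/seteqP; split => // t /= zx; move: x0; rewrite -zx eqxx.
have i0 : sint z = 0.
  rewrite (simple_integral_sum mu setT (proj1 s0) (proj1 (proj1 s0)))//.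
  rewrite big_seq big1// => x; rewrite in_fset_set; last exact: (proj1 (proj1 s0)).
  by rewrite inE => -[t _ <-]; rewrite scaler0.
have le_n n : (`|sint (s_ n)|%:E <= \int[mu]_t `|f t - s_ n t|%:E + \int[mu]_t `|f t|%:E)%E.
  have := simple_integral_dist sm (is_ n) s0; rewrite i0 subr0.
  by under [X in (_ + X)%E]eq_integral do rewrite subr0.
have cv : (`|sint (s_ n)|%:E)%E @[n --> \oo] --> (`|v|%:E)%E.
  by apply: cvg_EFin; [exact: nearW|exact: cvg_norm].
have ce : (\int[mu]_t `|f t - s_ n t|%:E + \int[mu]_t `|f t|%:E)%E @[n --> \oo]
   --> (\int[mu]_t `|f t|%:E)%E.
  rewrite -[X in _ --> X]add0e; apply: cvgeD; [|exact: es|exact: cvg_cst].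
  by rewrite ge0_adde_def// inE// integral_ge0.
apply: (lee_cvg_to cv ce).
by apply: nearW => n; exact: le_n.
Qed.
End bochner_integral_theory.

(** * Sums, bounded operators, changes of variable and restriction of the domain *)

Section bochner_operations.
Context d (T : measurableType d) (R : realType).
Variables (mu : {measure set T -> \bar R}) (X : completeNormedModType R).
Implicit Types (f g s r : T -> X) (D : set T) (v w : X).

Local Notation approx := (bochner_approximation mu setT).
Local Notation bint := (is_bochner_integral mu setT).
Local Notation sint := (simple_integral mu setT).

Lemma cvge0_le (a e : nat -> \bar R) : (forall n, 0 <= a n <= e n)%E ->
  e n @[n --> \oo] --> 0%E -> a n @[n --> \oo] --> 0%E.
Proof.
move=> ae e0; apply: (@squeeze_cvge _ _ _ _ (fun=> 0%E) _ e); last exact: e0.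
  exact: nearW.
exact: cvg_cst.
Qed.

Lemma bintD f g v w : bint f v -> bint g w -> bint (f \+ g) (v + w).
Proof.
move=> [s_ as_ sv] [r_ ar rw].
have smf := approx_strongly_measurable as_; have smg := approx_strongly_measurable ar.
have [[is_ sf es] [ir rg er]] := (as_, ar).
exists (fun n => s_ n \+ r_ n); last first.
  by under eq_fun do rewrite simple_integralD//; exact: cvgD.
split; first by move=> n; exact: integrable_simpleD.
  by apply: filterS2 sf rg => t sft rgt _; apply: cvgD; [exact: sft|exact: rgt].
apply: (@cvge0_le _ (fun n => \int[mu]_t `|f t - s_ n t|%:E +
    \int[mu]_t `|g t - r_ n t|%:E)%E); last first.
  by rewrite -[X in _ --> X]adde0; apply: cvgeD.
move=> n; rewrite integral_ge0//=.
have [m mm [m0 fm]] := strongly_measurable_distE smf (proj1 (is_ n)).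
have [k mk [k0 fk]] := strongly_measurable_distE smg (proj1 (ir n)).
rewrite -(ge0_ae_integralD mm mk _ _ m0 k0 fm fk)//.
apply: ge0_ae_le_lower_integral => [t|t|]; rewrite ?lee_fin ?addr_ge0//.
apply: aeW => t; rewrite lee_fin /= opprD addrACA.
exact: ler_normD.
Qed.

Lemma bint_linear (L : X -> X) (B : R) f v :
  linear L -> continuous L -> 0 <= B -> (forall x, `|L x| <= B * `|x|) ->
  bint f v -> bint (L \o f) (L v).
Proof.
move=> linL cL B0 LB [s_ as_ sv].
pose L' : {linear X -> X} := HB.pack L (GRing.isLinear.Build R X X *:%R L linL).
have L0 : L 0 = 0 by exact: (linear0 L').
have LBb (x y : X) : L (x - y) = L x - L y by exact: (linearB L').
have LD : {morph L : x y / x + y} by exact: (linearD L').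
have LZ (a : R) (x : X) : L (a *: x) = a *: L x by exact: (linearZ_LR L').
have smf := approx_strongly_measurable as_; have [is_ sf es] := as_.
have Lcvg (u : nat -> X) x : u n @[n --> \oo] --> x -> L (u n) @[n --> \oo] --> L x.
  by move=> ux; apply: continuous_cvg ux; exact: cL.
exists (fun n => L \o s_ n); last first.
  under eq_fun do rewrite (simple_integral_linear L0 LD LZ)//.
  exact: Lcvg.
split; first by move=> n; exact: integrable_simple_comp.
  by apply: filterS sf => t sft _; apply: Lcvg; exact: sft.
apply: (@cvge0_le _ (fun n => B%:E * \int[mu]_t `|f t - s_ n t|%:E)%E); last first.
  by rewrite -(mule0 B%:E); apply: cvgeZl.
move=> n; rewrite integral_ge0//=.
have [m mm [m0 fm]] := strongly_measurable_distE smf (proj1 (is_ n)).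
have -> : (\int[mu]_t `|f t - s_ n t|%:E = \int[mu]_t (m t)%:E)%E.
  apply: ge0_ae_eq_lower_integral => [t|t|]; rewrite ?lee_fin//.
  by apply: filterS fm => t ->.
rewrite -ge0_integralZl//; [|exact/measurable_EFinP|by move=> t _; rewrite lee_fin].
apply: ge0_ae_le_lower_integral => [t|t|]; rewrite -?EFinM ?lee_fin ?mulr_ge0//.
by apply: filterS fm => t ft; rewrite -EFinM lee_fin -ft -LBb.
Qed.

(** Serves the reflection [tau |-> t - tau], which turns the formula for the bounded solution into a
    convolution over the past. *)
Lemma bint_comp (phi : T -> T) f v : measurable_fun setT phi ->
  (forall y, exists x, phi x = y) ->
  (forall A, measurable A -> mu (phi @^-1` A) = mu A) ->
  bint f v -> bint (f \o phi) v.
Proof.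
move=> mphi sphi mup [s_ as_ sv].
have smf := approx_strongly_measurable as_; have [is_ sf es] := as_.
have aephi (P : T -> Prop) : {ae mu, forall t, P t} -> {ae mu, forall t, P (phi t)}.
  move=> [N [mN N0 PN]]; exists (phi @^-1` N); split.
  - by rewrite -[X in measurable X]setTI; exact: mphi.
  - by rewrite mup.
  - by move=> t /= nP; exact: PN.
have ssphi s : simple_function s -> simple_function (s \o phi).
  move=> ss; split; last first.
    move=> x; rewrite comp_preimage -[X in measurable X]setTI.
    by apply: mphi => //; exact: (proj2 ss).
  by apply: sub_finite_set (proj1 ss) => _ [t _ <-]; exists (phi t).
have iphi s : integrable_simple_function mu setT s ->
    integrable_simple_function mu setT (s \o phi).
  move=> [ss sfin]; split; first exact: ssphi.
  move=> x /sfin; rewrite !setTI.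
  by rewrite -[X in _ -> (mu X < _)%E]/(phi @^-1` (s @^-1` [set x])) mup//; case: ss.
exists (fun n => s_ n \o phi); last first.
  apply: cvg_trans sv; apply: near_eq_cvg; apply: nearW => n /=.
  have [ssn _] := is_ n.
  rewrite (simple_integral_sum mu setT ssn (proj1 ssn))//.
  rewrite (simple_integral_sum mu setT (ssphi _ ssn) (proj1 ssn)); last first.
    by move=> _ [t _ <-]; exists (phi t).
  apply: eq_bigr => x _; congr (fine _ *: _).
  rewrite !setTI.
  by rewrite -[X in _ = mu X]/(phi @^-1` (s_ n @^-1` [set x])) mup//; case: ssn.
split => [n||]; [exact: iphi|exact: (aephi _ sf)|].
apply: cvg_trans es; apply: near_eq_cvg; apply: nearW => n /=.
have [m mm [m0 fm]] := strongly_measurable_distE smf (proj1 (is_ n)).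
(* The pushforward formula asks for a measurable integrand, so [m] replaces the error on both
   sides. *)
have -> : (\int[mu]_t `|f t - s_ n t|%:E = \int[mu]_t (m t)%:E)%E.
  apply: ge0_ae_eq_lower_integral => [t|t|]; rewrite ?lee_fin//.
  by apply: filterS fm => t ->.
have -> : (\int[mu]_t `|f (phi t) - s_ n (phi t)|%:E = \int[mu]_t (m (phi t))%:E)%E.
  apply: ge0_ae_eq_lower_integral => [t|t|]; rewrite ?lee_fin//.
  by apply: filterS (aephi _ fm) => t ->.
transitivity (\int[pushforward mu phi]_t (m t)%:E)%E; last first.
  rewrite ge0_integral_pushforward//; first by exact/measurable_EFinP.
  by move=> t _; rewrite lee_fin.
by apply: eq_measure_integral => //= A mA _; rewrite -(mup A mA).
Qed.

Lemma simple_function_zext D s : measurable D -> simple_function s ->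
  simple_function (zext D s).
Proof.
move=> mD ss; exact: (fsimple_comp
  (fun a : bool * X => if a.1 then a.2 else 0) (fsimple_pair (fsimple_mem mD) ss)).
Qed.

Lemma zext_preimage D s (x : X) : x != 0 ->
  (zext D s) @^-1` [set x] = D `&` s @^-1` [set x].
Proof.
move=> x0; apply/seteqP; split => t; rewrite /preimage /zext/=.
  case: ifPn => [/set_mem Dt sx//|_ x0']; by move: x0; rewrite -x0' eqxx.
by move=> [Dt sx]; rewrite mem_set.
Qed.

Lemma simple_integral_zext D s : measurable D -> simple_function s ->
  simple_integral mu setT (zext D s) = simple_integral mu D s.
Proof.
move=> mD ss; have ssD := simple_function_zext mD ss.
pose A := range s `|` range (zext D s).
have fA : finite_set A by rewrite finite_setU; split; [case: ss|case: ssD].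
rewrite (simple_integral_sum mu setT ssD fA); last by move=> x; right.
rewrite (simple_integral_sum mu D ss fA); last by move=> x; left.
apply: eq_bigr => x _; have [->|x0] := eqVneq x 0; first by rewrite !scaler0.
by rewrite setTI zext_preimage.
Qed.

Lemma zext_distE D f s : (fun t => `|(zext D f) t - (zext D s) t|%:E)%E =
  (fun t => `|f t - s t|%:E)%E \_ D.
Proof.
apply/funext => t; rewrite /zext /patch; case: ifP => // _.
by rewrite subr0 normr0.
Qed.

Lemma zext_integrable_simple D s : measurable D ->
  integrable_simple_function mu D s ->
  integrable_simple_function mu setT (zext D s).
Proof.
move=> mD [ss sfin]; split; first exact: simple_function_zext.
by move=> x x0; rewrite setTI zext_preimage//; exact: sfin.
Qed.

Lemma bochner_approximation_zext D f (s_ : nat -> T -> X) : measurable D ->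
  bochner_approximation mu D f s_ -> approx (zext D f) (fun n => zext D (s_ n)).
Proof.
move=> mD [is_ sf es]; split => [n||].
- exact: zext_integrable_simple.
- apply: filterS sf => t st _; rewrite /zext.
  by case: ifPn => [/set_mem/st//|_]; exact: cvg_cst.
- by under eq_fun do rewrite zext_distE -integral_mkcond.
Qed.

(** The rules of integration are proved on the whole space; this equivalence carries them over to a
    domain [D]. *)
Lemma is_bochner_integral_zext D f v : measurable D ->
  is_bochner_integral mu D f v <-> bint (zext D f) v.
Proof.
move=> mD; split=> [[s_ as_ sv]|[s_ as_ sv]].
  exists (fun n => zext D (s_ n)); first exact: bochner_approximation_zext.
  have [is_ _ _] := as_.
  apply: cvg_trans sv; apply: near_eq_cvg; apply: nearW => n /=.
  by rewrite simple_integral_zext//; exact: (proj1 (is_ n)).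
(* Cutting the approximants down to [D] cannot increase their distance to [zext D f], which vanishes
   off [D]. *)
have asD : approx (zext D f) (fun n => zext D (s_ n)).
  have [is_ sf es] := as_; split => [n||].
  - have [ss sfin] := is_ n; apply: zext_integrable_simple => //; split => // x x0.
    apply: le_lt_trans (sfin _ x0); apply: le_measure; rewrite ?inE ?setTI.
    + by apply: measurableI => //; exact: (proj2 ss).
    + exact: (proj2 ss).
    + by move=> t [].
  - apply: filterS sf => t /(_ I); rewrite /zext.
    by case: ifPn => // _ _ _; exact: cvg_cst.
  - apply: (cvge0_le _ es) => n; rewrite integral_ge0//=.
    apply: ge0_ae_le_lower_integral => [t|t|]; rewrite ?lee_fin//.
    apply: aeW => t; rewrite lee_fin /zext.
    by case: ifPn => // _; rewrite subrr normr0.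
exists (fun n => zext D (s_ n)).
  have [is_ sf es] := asD; split => [n||].
  - have [ss sfin] := is_ n; split => // x x0.
    apply: le_lt_trans (sfin _ x0); apply: le_measure; rewrite ?inE ?setTI.
    + by apply: measurableI => //; exact: (proj2 ss).
    + exact: (proj2 ss).
    + by move=> t [].
  - by apply: filterS sf => t /(_ I) st Dt; move: st; rewrite {2}/zext mem_set.
  - apply: (cvge0_le _ es) => n; rewrite integral_ge0//=.
    rewrite integral_mkcond; apply: ge0_ae_le_lower_integral => [t|t|].
    + by apply: erestrict_ge0 => u _; rewrite lee_fin.
    + by rewrite lee_fin.
    + apply: aeW => t; rewrite /patch; case: ifPn => [tD|_]; last by rewrite lee_fin.
      by rewrite lee_fin /zext tD.
have := approx_simple_integral_cvg as_ asD sv.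
apply: cvg_trans; apply: near_eq_cvg; apply: nearW => n /=.
have [is_ _ _] := as_; have [ss _] := is_ n.
have ssD := simple_function_zext mD ss.
rewrite -(simple_integral_zext mD ssD); congr simple_integral.
by apply/funext => t; rewrite /zext; case: ifP.
Qed.

Lemma bochner_integral_zext D f : measurable D ->
  bochner_integral mu D f = bochner_integral mu setT (zext D f).
Proof.
move=> mD; rewrite /bochner_integral; congr (xget _ _).
by apply/funext => v; apply/propext; exact: is_bochner_integral_zext.
Qed.

End bochner_operations.

(** * Strong measurability and Bochner's integrability criterion *)

Section strong_measurability.
Context d (T : measurableType d) (R : realType).
Variables (mu : {measure set T -> \bar R}) (X : completeNormedModType R).
Implicit Types (f g s r : T -> X) (D : set T) (v w : X).

Import HBNNSimple.

Local Notation smeas := (strongly_measurable mu setT).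

(** Only null sets have to be respected, because [wrap] does not preserve the measure. *)
Lemma strongly_measurable_comp (psi : T -> T) f : measurable_fun setT psi ->
  (forall A, measurable A -> mu A = 0%E -> mu (psi @^-1` A) = 0%E) ->
  smeas f -> smeas (f \o psi).
Proof.
move=> mpsi psi0 /strongly_measurableP[s_ ss [N [mN N0 sN]]].
have mpre A : measurable A -> measurable (psi @^-1` A).
  by move=> mA; rewrite -[X in measurable X]setTI; exact: mpsi.
apply/strongly_measurableP; exists (fun n => s_ n \o psi).
  move=> n; have [fs ms] := ss n; split; last first.
    by move=> x; exact: (mpre (s_ n @^-1` [set x])).
  by apply: sub_finite_set fs => _ [t _ <-]; exists (psi t).
exists (psi @^-1` N); split; [exact: mpre|exact: psi0|].
by move=> t /= h; apply: sN.
Qed.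

Lemma strongly_measurable_zext D f : measurable D -> smeas f -> smeas (zext D f).
Proof.
move=> mD /strongly_measurableP[s_ ss sf].
apply/strongly_measurableP; exists (fun n => zext D (s_ n)).
  by move=> n; exact: (simple_function_zext mD (ss n)).
apply: filterS sf => t st; rewrite /zext; case: ifP => // _; exact: cvg_cst.
Qed.

Lemma within_continuous_cvg (A : set R) (h : R -> X) (u : nat -> R) (a : R) :
  {within A, continuous h} -> A a -> (forall n, A (u n)) ->
  u n @[n --> \oo] --> a -> h (u n) @[n --> \oo] --> h a.
Proof.
move=> /subspace_continuousP hA Aa Au ua.
apply: (@cvg_comp _ _ _ u h _ (within A (nbhs a))); last exact: hA.
move=> P /ua; rewrite /nbhs/=; apply: filterS => n; exact.
Qed.

(** The map [t |-> S t] is continuous only pointwise in [x]. Approximating [sigma] and [f] by simple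
    functions at once still works: strong continuity handles the time variable at the fixed vector
    [f t], and the uniform Lipschitz constant [C] handles the replacement of [f t] by [s_ n t]. *)
Lemma strongly_measurable_family (S : R -> X -> X) (C : R) (sigma : T -> R) f :
  (forall t x y, 0 <= t -> `|S t x - S t y| <= C * `|x - y|) ->
  (forall x, {within `[0, +oo[, continuous (fun t => S t x)}) ->
  measurable_fun setT sigma -> (forall t, 0 <= sigma t) ->
  smeas f -> smeas (fun t => S (sigma t) (f t)).
Proof.
move=> SC Scont msigma sigma0 /strongly_measurableP[s_ ss sf].
have msigmaE : measurable_fun setT (EFin \o sigma) by exact/measurable_EFinP.
pose sg := nnsfun_approx measurableT msigmaE.
have sgcvg t : sg n t @[n --> \oo] --> sigma t.
  have /fine_cvgP[_] : EFin \o sg^~ t @ \oo --> (sigma t)%:E.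
    by apply: (@cvg_nnsfun_approx _ _ _ _ measurableT _ msigmaE) => // x _; rewrite lee_fin.
  exact.
have fsg n : fsimple (sg n).
  by split; [exact: fimfunP|move=> x; exact: measurable_funPTI].
apply/strongly_measurableP; exists (fun n t => S (sg n t) (s_ n t)).
  by move=> n; exact: (fsimple_comp (fun a : R * X => S a.1 a.2) (fsimple_pair (fsg n) (ss n))).
apply: filterS sf => t st.
have sg0 n : 0 <= sg n t by [].
have h1 : S (sg n t) (f t) @[n --> \oo] --> S (sigma t) (f t).
  apply: (within_continuous_cvg (Scont (f t))) => //=.
  - by rewrite in_itv/= sigma0.
  - by move=> n; rewrite in_itv/= sg0.
apply: cvg_sub0 h1.
apply: (@cvg0_of_norm_le _ _ _ (fun n => (C * `|s_ n t - f t|)%:E)).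
  by move=> n; rewrite lee_fin !fctE SC.
apply: cvg_EFin; first exact: nearW.
rewrite -[X in _ --> X](mulr0 C); apply: cvgM; first exact: cvg_cst.
apply/norm_cvg0P; rewrite -(subrr (f t)); apply: cvgB => //; exact: cvg_cst.
Qed.

(** Approximants of a strongly measurable function need be neither integrable nor dominated.
    Truncating them where they exceed twice [|f|] gives both, with errors at most [3 * G], and
    dominated convergence concludes. *)
Lemma bochner_integrable_dominated f (G : T -> R) : smeas f ->
  mu.-integrable setT (EFin \o G) -> {ae mu, forall t, `|f t| <= G t} ->
  bochner_integrable mu setT f.
Proof.
move=> sf iG fG; have /strongly_measurableP[s_ ss sfc] := sf.
have [m mm [m0 fm]] := strongly_measurable_distE sf (fsimple_cst T (0 : X)).
have {}fm : {ae mu, forall t, `|f t| = m t}.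
  by apply: filterS fm => t; rewrite subr0.
(* Off [E n] the distance from [s_ n t] to [f t] is at least [m t], so replacing [s_ n t] by 0 there
   does not spoil convergence. *)
pose E n := [set t | `|s_ n t| <= 2 * m t].
have mE n : measurable (E n).
  rewrite -[E n]setTI; apply: (measurable_fun_le measurableT).
    exact: (fsimple_measurable (fun x : X => `|x|) (ss n)).
  exact: measurable_funM.
pose r_ n := zext (E n) (s_ n).
have sr n : simple_function (r_ n) by exact: (simple_function_zext (mE n) (ss n)).
have im : (\int[mu]_t (m t)%:E < +oo)%E.
  have /integrableP[_] := iG; apply: le_lt_trans.
  apply: ge0_ae_le_lower_integral => [t|t|]; rewrite ?lee_fin//.
  apply: filterS2 fm fG => t <- fGt; rewrite lee_fin (le_trans fGt)//.
  exact: ler_norm.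
have ir n : integrable_simple_function mu setT (r_ n).
  split => // x x0; rewrite setTI; set A := _ @^-1` _.
  have mA : measurable A by exact: (proj2 (sr n)).
  (* Chebyshev's inequality: on the fibre over [x != 0] the truncation forces [m t >= |x| / 2]. *)
  have : ((`|x| / 2)%:E * mu A <= \int[mu]_t (m t)%:E)%E.
    rewrite -[X in mu X]setIT -integral_indic// -ge0_integralZl//; last first.
      exact/measurable_EFinP.
    apply: ge0_ae_le_lower_integral => [t|t|].
    - by rewrite -EFinM lee_fin mulr_ge0// divr_ge0.
    - by rewrite lee_fin.
    apply: aeW => t; rewrite -EFinM lee_fin indicE.
    case: (boolP (t \in A)) => [/set_mem|_]; last by rewrite mulr0.
    rewrite mulr1 ler_pdivrMr// mulrC /A /preimage/= /r_ /zext.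
    case: ifPn => [/set_mem sm <- //|_ x0']; by move: x0; rewrite -x0' eqxx.
  move=> h; rewrite ltey; apply/eqP => Aoo; move: h.
  rewrite Aoo gt0_muley ?lte_fin ?divr_gt0 ?normr_gt0// leye_eq => /eqP h.
  by move: im; rewrite h ltxx.
have /choice[h hP] n : exists h : T -> R, [/\ measurable_fun setT h, (forall t, 0 <= h t) &
    {ae mu, forall t, `|f t - r_ n t| = h t}].
  by have [h mh [h0 fh]] := strongly_measurable_distE sf (sr n); exists h.
have rcvg t : `|f t| = m t -> s_ n t @[n --> \oo] --> f t ->
    r_ n t @[n --> \oo] --> f t.
  move=> fmt st.
  apply: (@cvg_sub0 _ _ _ _ _ _ (fun=> f t)); last exact: cvg_cst.
  apply: (@cvg0_of_norm_le _ _ _ (fun n => (`|s_ n t - f t|)%:E)).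
    move=> n; rewrite lee_fin !fctE /r_ /zext; case: ifPn => // /negP tE.
    rewrite sub0r normrN fmt; move: tE; rewrite inE /E/= => /negP; rewrite -ltNge => tE.
    have := lerB_dist (s_ n t) (f t); rewrite fmt; apply: le_trans.
    by rewrite lerBrDr -mulr2n -mulr_natl ltW.
  apply: cvg_EFin; first exact: nearW.
  apply/norm_cvg0P; rewrite -(subrr (f t)); apply: cvgB => //; exact: cvg_cst.
exists r_; split => //.
  by apply: filterS2 fm sfc => t fmt st _; exact: rcvg.
have mh n : measurable_fun setT (EFin \o h n).
  by apply/measurable_EFinP; case: (hP n).
have fh : {ae mu, forall t n, `|f t - r_ n t| = h n t}.
  by apply/ae_foralln => n; case: (hP n).
have rf t : `|f t| = m t -> forall n, `|f t - r_ n t| <= 3 * `|f t|.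
  move=> fmt n; rewrite /r_ /zext; case: ifPn => [/set_mem|_]; last first.
    by rewrite subr0 ler_peMl// ler1n.
  by rewrite /E/= -fmt => sE; rewrite (le_trans (ler_normB _ _))//; lra.
have h_cvg : {ae mu, forall t, setT t -> (EFin \o h n) t @[n --> \oo] --> 0%E}.
  apply: filterS3 fm sfc fh => t fmt st fht _.
  rewrite (_ : (fun n => _) = (fun n => `|f t - r_ n t|%:E)%E); last first.
    by apply/funext => n; rewrite fht.
  apply: cvg_EFin; first exact: nearW.
  apply/norm_cvg0P; rewrite -(subrr (f t)); apply: cvgB; first exact: cvg_cst.
  exact: rcvg.
pose G3 t := 3 * G t.
have h_dom : {ae mu, forall t n, setT t -> (`|(EFin \o h n) t| <= (EFin \o G3) t)%E}.
  apply: filterS3 fm fG fh => t fmt fGt fht n _ /=.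
  rewrite lee_fin -fht normr_id (le_trans (rf t fmt n))//.
  by rewrite ler_pM2l.
have i3G : mu.-integrable setT (EFin \o G3).
  have -> : EFin \o G3 = (fun t => 3%:E * (EFin \o G) t)%E.
    by apply/funext => t /=; rewrite EFinM.
  exact: integrableZl.
have [_ _] := dominated_convergence measurableT mh (measurable_cst 0%E) h_cvg i3G h_dom.
rewrite integral0; apply: cvg_trans; apply: near_eq_cvg; apply: nearW => n /=.
have [_ h0 fhn] := hP n.
apply: ge0_ae_eq_lower_integral => [t|t|]; rewrite ?lee_fin//.
by apply: filterS fhn => t ->.
Qed.

End strong_measurability.

(** * Essential suprema on the line; translations, reflections and periodization *)

Section lebesgue_measure_facts.
Context (R : realType).
Local Notation mu := (@lebesgue_measure R).

(** [Lnorm] at [+oo] is the essential supremum only under this test on the measure of the whole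
    space. *)
Lemma lebesgue_measureT_gt0 : (0 < mu setT)%E.
Proof.
apply: (@lt_le_trans _ _ (mu `[0, 1])); last by apply: le_measure; rewrite ?inE.
by rewrite lebesgue_measure_itv/= lte_fin ltr01 sube0 lte_fin ltr01.
Qed.

(** The restriction in [Linfty_norm] takes the value 0 off [D]; [0 <= c] makes the bound true
    there. *)
Lemma Linfty_norm_leP (V : normedModType R) (D : set R) (g : R -> V) (c : \bar R) :
  (0 <= c)%E ->
  (Linfty_norm D g <= c)%E <-> {ae mu, forall t, D t -> (`|g t|%:E <= c)%E}.
Proof.
move=> c0; rewrite /Linfty_norm unlock /= lebesgue_measureT_gt0.
have E t : (abse \o (fun t => `|g t|%:E) \_ D)%E t = (if t \in D then `|g t|%:E else 0)%E.
  by rewrite /= /patch; case: ifP => _; rewrite ?gee0_abs ?lee_fin// abse0.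
split=> [/ess_supP H|H].
  by apply: (ae_imply H) => t; rewrite E => /[swap] Dt; rewrite mem_set.
apply/ess_supP; apply: (ae_imply H) => t; rewrite E.
by case: ifPn => // /set_mem Dt; exact.
Qed.

Lemma Linfty_norm_ge0 (V : normedModType R) (D : set R) (g : R -> V) :
  (0 <= Linfty_norm D g)%E.
Proof. exact: Lnorm_ge0. Qed.

Lemma Linfty_norm_nonincreasing (V : normedModType R) (g : R -> V) (A B : set R) :
  A `<=` B -> (Linfty_norm A g <= Linfty_norm B g)%E.
Proof.
move=> AB; apply/Linfty_norm_leP; first exact: Linfty_norm_ge0.
have /(Linfty_norm_leP _ _ (Linfty_norm_ge0 B g)) H := le_refl (Linfty_norm B g).
by apply: (ae_imply H) => t h /AB; exact: h.
Qed.

Lemma ess_limsupE (V : normedModType R) (g : R -> V) :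
  ess_limsup g = ereal_inf (range (fun T => Linfty_norm `]T, +oo[ g)).
Proof.
apply/cvg_lim => //; apply: nonincreasing_cvge => x y xy.
by apply: Linfty_norm_nonincreasing; apply: subset_itvr; rewrite bnd_simp.
Qed.

Lemma ess_limsup_le (V : normedModType R) (g : R -> V) (T : R) :
  (ess_limsup g <= Linfty_norm `]T, +oo[ g)%E.
Proof. by rewrite ess_limsupE; apply: ereal_inf_lbound; exists T. Qed.

Lemma ess_limsup_ge (V : normedModType R) (g : R -> V) (c : \bar R) :
  (forall T, c <= Linfty_norm `]T, +oo[ g)%E -> (c <= ess_limsup g)%E.
Proof.
by move=> h; rewrite ess_limsupE; apply: le_ereal_inf_tmp => _ [T _ <-].
Qed.

Lemma ess_limsup_lt (V : normedModType R) (g : R -> V) (c : \bar R) :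
  (ess_limsup g < c)%E -> exists T, (Linfty_norm `]T, +oo[ g < c)%E.
Proof. by rewrite ess_limsupE => /ereal_inf_lt [_ [T _ <-]]; exists T. Qed.

Lemma lebesgue_measure_shift (a : R) (A : set R) : measurable A ->
  mu ((fun t => a + t) @^-1` A) = mu A.
Proof.
have mphi : measurable_fun setT (fun t : measurableTypeR R => a + t : measurableTypeR R).
  exact: measurable_funD.
pose phi : {mfun measurableTypeR R >-> measurableTypeR R} :=
  HB.pack (fun t : R => a + t) (isMeasurableFun.Build _ _ _ _ _ mphi).
move=> mA; apply/esym.
apply: (@lebesgue_measure_unique R (pushforward mu phi)) => //= _ [[x y]] _ <-.
rewrite /pushforward (_ : phi @^-1` _ = `]x - a, y - a]%classic).
  by rewrite !lebesgue_measure_itv/= !lte_fin ltrD2r -!EFinB opprB addrA subrK.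
apply/seteqP; split => t; rewrite /= !in_itv/=.
  by rewrite ltrBlDl lerBrDl.
by rewrite ltrBlDl lerBrDl.
Qed.

Lemma lebesgue_measure_reflect (a : R) (A : set R) : measurable A ->
  mu ((fun t => a - t) @^-1` A) = mu A.
Proof.
move=> mA; rewrite -[RHS](lebesgue_measure_shift a mA).
rewrite -[RHS]lebesgue_measureN//.
have mphi : measurable_fun setT (fun t : measurableTypeR R => a + t : measurableTypeR R).
  exact: measurable_funD.
by rewrite -[X in measurable X]setTI; exact: mphi.
Qed.

Lemma ae_neq (a : R) : {ae mu, forall t, t != a}.
Proof.
exists [set a]; split => //; first exact: lebesgue_measure_set1.
by move=> t /= /negP; rewrite negbK => /eqP.
Qed.

Lemma measurable_itvR (i : interval R) : measurable ([set` i] : set (measurableTypeR R)).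
Proof. exact: measurable_itv. Qed.

Lemma measurable_reflect (t : R) :
  measurable_fun [set: measurableTypeR R] (fun tau : measurableTypeR R => t - tau : measurableTypeR R).
Proof. exact: measurable_funB. Qed.

Lemma measurable_shift (a : R) :
  measurable_fun [set: measurableTypeR R] (fun t : measurableTypeR R => a + t : measurableTypeR R).
Proof. exact: measurable_funD. Qed.

Lemma ae_shift (a : R) (Q : R -> Prop) : {ae mu, forall t, Q t} ->
  {ae mu, forall t, Q (a + t)}.
Proof.
move=> [N [mN N0 QN]]; exists ((fun t => a + t) @^-1` N); split.
- by rewrite -[X in measurable X]setTI; exact: measurable_shift.
- by rewrite -[RHS]N0; exact: lebesgue_measure_shift.
- by move=> t /= nQ; exact: QN.
Qed.

Lemma ae_reflect (a : R) (Q : R -> Prop) : {ae mu, forall t, Q t} ->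
  {ae mu, forall t, Q (a - t)}.
Proof.
move=> [N [mN N0 QN]]; exists ((fun t => a - t) @^-1` N); split.
- by rewrite -[X in measurable X]setTI; exact: measurable_reflect.
- by rewrite -[RHS]N0; exact: lebesgue_measure_reflect.
- by move=> t /= nQ; exact: QN.
Qed.

Lemma ae_exists_between (a b : R) (Q : R -> Prop) : a < b ->
  {ae mu, forall t, Q t} -> exists2 t, a < t < b & Q t.
Proof.
move=> ab [N [mN N0 QN]]; apply: contrapT => nQ.
have : (mu `]a, b[ <= mu N)%E.
  apply: le_measure; rewrite ?inE// => t /= atb; apply: QN => Qt; apply: nQ.
  by exists t => //; move: atb; rewrite in_itv.
rewrite N0 lebesgue_measure_itv/= lte_fin ab -EFinB lee_fin subr_le0.
by rewrite leNgt ab.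
Qed.

(* The [q]-periodic map that is the identity on [-q, 0). *)
Definition wrap (q t : R) : R := t - q - q * (Num.floor (t / q))%:~R.

(** On this interval the floor of [t / q] is -1, and its contribution cancels the summand [- q] of
    [wrap]. *)
Lemma wrapE (q t : R) : - q < t < 0 -> wrap q t = t.
Proof.
move=> /andP[qt t0]; have q0 : 0 < q by rewrite -oppr_lt0 (lt_trans qt).
rewrite /wrap (floor_def (m := -1)); first by rewrite mulrN1 opprK subrK.
by rewrite addNr ler_pdivlMr// ltr_pdivrMr// mul0r mulN1r ltW//=.
Qed.

Lemma wrap_periodic (q t : R) : 0 < q -> wrap q (t + q) = wrap q t.
Proof.
move=> q0; rewrite /wrap mulrDl divff ?lt0r_neq0// floorDrz ?rpred1// floor1.
by rewrite intrD mulrDr mulr1; ring.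
Qed.

Lemma measurable_wrap (q : R) : 0 < q ->
  measurable_fun [set: measurableTypeR R] (wrap q : measurableTypeR R -> measurableTypeR R).
Proof.
move=> q0; apply: measurable_funB; first exact: measurable_funB.
apply: measurable_funM => //; apply: nondecreasing_measurable => // x y xy.
by rewrite ler_int le_floor// ler_pM2r// invr_gt0.
Qed.

Lemma wrap_null (q : R) (D : set (measurableTypeR R)) : 0 < q -> measurable D -> mu D = 0%E ->
  mu (wrap q @^-1` D) = 0%E.
Proof.
move=> q0 mD D0.
have shift0 a : mu.-negligible ((fun t => a + t) @^-1` D).
  apply/negligibleP; last by rewrite -[RHS]D0; exact: lebesgue_measure_shift.
  by rewrite -[X in measurable X]setTI; exact: measurable_shift.
apply: measure_negligible.
  by rewrite -[X in measurable X]setTI; exact: measurable_wrap.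
(* The preimage lies in countably many translates of [D], one for each value of the floor: the first
   translate in [N n] belongs to the value n, the second to -(n + 1). *)
pose N n := ((fun t => - (q + q * n%:R) + t) @^-1` D) `|` ((fun t => q * n%:R + t) @^-1` D).
have : mu.-negligible (\bigcup_n N n).
  by apply: negligible_bigcup => n; exact: negligibleU.
apply: negligibleS => t; rewrite /preimage/= /wrap.
case: (Num.floor (t / q)) => n Dt; exists n => //; [left|right] => /=.
  suff -> : - (q + q * n%:R) + t = t - q - q * (Posz n)%:~R by [].
  by rewrite -pmulrn; ring.
suff -> : q * n%:R + t = t - q - q * (Negz n)%:~R by [].
by rewrite NegzE mulrNz -pmulrn -natr1; ring.
Qed.

Lemma ae_wrap (q : R) (Q : R -> Prop) : 0 < q -> {ae mu, forall t, Q t} ->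
  {ae mu, forall t, Q (wrap q t)}.
Proof.
move=> q0 [N [mN N0 QN]]; exists (wrap q @^-1` N); split.
- by rewrite -[X in measurable X]setTI; exact: measurable_wrap.
- exact: wrap_null.
- by move=> t /= nQ; exact: QN.
Qed.

End lebesgue_measure_facts.

(** * Integrability of the norm, subdomains and a.e. equal integrands *)

Section integrable_norm.
Context d (T : measurableType d) (R : realType).
Variables (mu : {measure set T -> \bar R}) (X : completeNormedModType R).
Implicit Types (f g s : T -> X) (D : set T).

Lemma integrable_simple_norm s : integrable_simple_function mu setT s ->
  (\int[mu]_t `|s t|%:E < +oo)%E.
Proof.
move=> is_; rewrite (integral_norm_simple mu (proj1 is_)).
apply: lte_sum_pinfty => x _; have [->|x0] := eqVneq x 0.
  by rewrite normr0 mul0e.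
by apply: lte_mul_pinfty => //; have := (proj2 is_) x x0; rewrite setTI.
Qed.

(** Converse of the domination criterion: the representative [m] becomes the dominating function for
    restrictions of [f] and for its images under the semigroup. *)
Lemma bochner_integrable_norm f : bochner_integrable mu setT f ->
  exists2 m : T -> R, mu.-integrable setT (EFin \o m) &
    (forall t, 0 <= m t) /\ {ae mu, forall t, `|f t| = m t}.
Proof.
move=> [s_ as_]; have sf := approx_strongly_measurable as_.
have [is_ _ /fine_cvgP[[n _ /(_ n (leqnn n))] fin_n _]] := as_.
have [m mm [m0 fm]] := strongly_measurable_distE sf (fsimple_cst T (0 : X)).
have {}fm : {ae mu, forall t, `|f t| = m t}.
  by apply: (ae_imply fm) => t; rewrite subr0.
have [k mk [k0 fk]] := strongly_measurable_distE sf (proj1 (is_ n)).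
have ms : measurable_fun setT (fun t => `|s_ n t|).
  exact: (fsimple_measurable (fun x : X => `|x|) (proj1 (is_ n))).
exists m => //; apply/integrableP; split; first exact/measurable_EFinP.
apply: (@le_lt_trans _ _ (\int[mu]_t (`|f t - s_ n t| + `|s_ n t|)%:E)%E).
  apply: ge0_ae_le_lower_integral => [t|t|]; rewrite ?lee_fin ?addr_ge0//.
  apply: (ae_imply fm) => t /= <-; rewrite lee_fin normr_id.
  by rewrite -{1}(subrK (s_ n t) (f t)) ler_normD.
rewrite (ge0_ae_integralD mk ms _ _ k0 _ fk)//; last exact: aeW.
apply: lte_add_pinfty; last exact: integrable_simple_norm.
by rewrite ltey; move: fin_n; rewrite fin_numE => /andP[].
Qed.

Lemma bochner_integrable_zext D f : measurable D ->
  bochner_integrable mu D f -> bochner_integrable mu setT (zext D f).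
Proof.
by move=> mD [s_ as_]; exists (fun n => zext D (s_ n)); exact: bochner_approximation_zext.
Qed.

Lemma bochner_integrable_of_zext D f : measurable D ->
  bochner_integrable mu setT (zext D f) -> bochner_integrable mu D f.
Proof.
move=> mD /bochner_integrableP[v /(is_bochner_integral_zext _ _ _ mD)[s_ as_ _]].
by exists s_.
Qed.

Lemma bochner_integrable_strongly_measurable f : bochner_integrable mu setT f ->
  strongly_measurable mu setT f.
Proof. by move=> [s_]; exact: approx_strongly_measurable. Qed.

Lemma bochner_integrable_zextS (A B : set T) f : measurable A -> A `<=` B ->
  bochner_integrable mu setT (zext B f) -> bochner_integrable mu setT (zext A f).
Proof.
move=> mA AB iB; have [m im [m0 fm]] := bochner_integrable_norm iB.
have zE : zext A f = zext A (zext B f).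
  apply/funext => t; rewrite /zext; case: ifPn => // /set_mem/AB Bt.
  by rewrite mem_set.
apply: (bochner_integrable_dominated _ im).
  rewrite zE; apply: strongly_measurable_zext => //.
  exact: bochner_integrable_strongly_measurable.
apply: (ae_imply fm) => t <-; rewrite /zext.
case: ifPn => [/set_mem/AB Bt|_]; first by rewrite mem_set.
by rewrite normr0.
Qed.

(** The two predicates from which [xget] chooses coincide, so the junk values agree as well. *)
Lemma bochner_integral_ae_eq D f g : measurable D ->
  {ae mu, forall t, D t -> f t = g t} ->
  bochner_integral mu D f = bochner_integral mu D g.
Proof.
move=> mD fg; rewrite !(bochner_integral_zext _ _ mD) /bochner_integral.
have zfg : {ae mu, forall t, zext D f t = zext D g t}.
  by apply: (ae_imply fg) => t fgt; rewrite /zext; case: ifPn => // /set_mem.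
congr (xget _ _); apply/funext => v; apply/propext; split; apply: bint_ae_eq => //.
exact: (ae_imply zfg).
Qed.

End integrable_norm.

(** * Convolution with the semigroup and variation of constants *)

Section semigroup_convolution.
Context (R : realType) (X : completeNormedModType R).
Variables (S : R -> X -> X) (C delta : R).
Hypotheses (C0 : 0 < C) (delta0 : 0 < delta).
Hypothesis S_semigroup : strongly_continuous_semigroup S.
Hypothesis S_decay : forall (t : R) (x : X), 0 <= t ->
  `|S t x| <= C * expR (- delta * t) * `|x|.
Local Notation mu := (@lebesgue_measure R).
Implicit Types (F : R -> X) (D E : set (measurableTypeR R)).

(** Common form of both solutions: [D] is []0, t[] in the mild solution and []-oo, t[] in the
    bounded one. *)
Definition conv D F t : X :=
  bochner_integral mu setT (zext D (fun tau => S (t - tau) (F tau))).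

Definition conv_integrable D F t : Prop :=
  bochner_integrable mu setT (zext D (fun tau => S (t - tau) (F tau))).

Lemma semigroup0 t : 0 <= t -> S t 0 = 0.
Proof.
move=> t0; have [linS _] : linear (S t) /\ continuous (S t) by case: S_semigroup => + _ _ _; exact.
by have := linS (- 1) 0 0; rewrite !scaleN1r oppr0 addr0 addNr.
Qed.

Lemma semigroupB t x y : 0 <= t -> S t (x - y) = S t x - S t y.
Proof.
move=> t0; have [linS _] : linear (S t) /\ continuous (S t) by case: S_semigroup => + _ _ _; exact.
by have := linS (- 1) y x; rewrite !scaleN1r [- y + x]addrC [- S t y + _]addrC.
Qed.

Lemma semigroupD t x y : 0 <= t -> S t (x + y) = S t x + S t y.
Proof.
move=> t0; have [linS _] : linear (S t) /\ continuous (S t) by case: S_semigroup => + _ _ _; exact.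
by have := linS 1 x y; rewrite !scale1r.
Qed.

Lemma semigroup_norm_le t x : 0 <= t -> `|S t x| <= C * `|x|.
Proof.
move=> t0; apply: (le_trans (S_decay x t0)); apply: ler_wpM2r => //.
by rewrite ler_piMr ?(ltW C0)// expR_le1 mulNr oppr_le0 mulr_ge0// ltW.
Qed.

Lemma strongly_measurable_conv D F t : D `<=` `]-oo, t] ->
  strongly_measurable mu setT (zext D F) ->
  strongly_measurable mu setT (zext D (fun tau => S (t - tau) (F tau))).
Proof.
move=> Dt sF.
(* Clamping the time at 0 keeps the semigroup parameter nonnegative everywhere; off [D] this changes
   nothing because the semigroup maps 0 to 0. *)
have -> : zext D (fun tau => S (t - tau) (F tau)) =
    (fun tau => S (Num.max 0 (t - tau)) (zext D F tau)).
  apply/funext => tau; rewrite /zext; case: ifPn => [/set_mem/Dt|_]; last first.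
    by rewrite semigroup0// le_max lexx.
  by rewrite /= in_itv/= => taut; rewrite (max_idPr _)// subr_ge0.
have SC s x y : 0 <= s -> `|S s x - S s y| <= C * `|x - y|.
  by move=> s0; rewrite -semigroupB//; exact: semigroup_norm_le.
have Scont x : {within `[0, +oo[, continuous (fun s => S s x)} by case: S_semigroup.
have msigma : measurable_fun setT (fun tau : measurableTypeR R => Num.max 0 (t - tau)).
  apply: (@measurable_maxr _ _ _ _ (cst 0) (fun tau : measurableTypeR R => t - tau : R)) => //.
  exact: measurable_funB.
have sigma0 (tau : R) : 0 <= Num.max 0 (t - tau) by rewrite le_max lexx.
exact: (strongly_measurable_family SC Scont msigma sigma0 sF).
Qed.

Lemma conv_integrable_of_integrable D F t : D `<=` `]-oo, t] ->
  bochner_integrable mu setT (zext D F) -> conv_integrable D F t.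
Proof.
move=> Dt iF; have [m im [m0 Fm]] := bochner_integrable_norm iF.
apply: (@bochner_integrable_dominated _ _ _ _ _ _ (fun tau => C * m tau)).
- by apply: strongly_measurable_conv => //; exact: bochner_integrable_strongly_measurable.
- by under [X in _.-integrable _ X]eq_fun do rewrite /= EFinM; exact: integrableZl.
- apply: (ae_imply Fm) => tau <-; rewrite /zext; case: ifPn => [/set_mem/Dt|_]; last first.
    by rewrite normr0 mulr0.
  by rewrite /= in_itv/= => taut; apply: semigroup_norm_le; rewrite subr_ge0.
Qed.

Lemma conv_integrableS D E F t : measurable D -> D `<=` E ->
  conv_integrable E F t -> conv_integrable D F t.
Proof. by move=> mD DE; rewrite /conv_integrable => iE; exact: bochner_integrable_zextS mD DE iE. Qed.

(** The bounded operator [S (t - a)] passes under the integral and the semigroup law merges it with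
    [S (a - tau)]. *)
Lemma conv_shift D F a t : measurable D -> D `<=` `]-oo, a] -> a <= t ->
  conv_integrable D F a -> conv_integrable D F t /\ conv D F t = S (t - a) (conv D F a).
Proof.
move=> mD Da at_ /bochner_integrableP[v Fv].
have ta0 : 0 <= t - a by rewrite subr_ge0.
have [linS cS] : linear (S (t - a)) /\ continuous (S (t - a)).
  by case: S_semigroup => + _ _ _; exact.
have := bint_linear linS cS (ltW C0) (fun x => semigroup_norm_le x ta0) Fv.
have -> : S (t - a) \o zext D (fun tau => S (a - tau) (F tau)) =
    zext D (fun tau => S (t - tau) (F tau)).
  apply/funext => tau; rewrite /zext /=; case: ifPn => [/set_mem/Da|_]; last exact: semigroup0.
  rewrite /= in_itv/= => taua; have [_ _ SD _] := S_semigroup.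
  by rewrite -SD ?subr_ge0// addrA subrK.
move=> Fv'; split; first by apply/bochner_integrableP; exists (S (t - a) v).
by rewrite /conv (bochner_integralE Fv) (bochner_integralE Fv').
Qed.

(** Variation of constants for an arbitrary past [D]. The decomposition of [D'] is only a.e. because
    the instant [a] lies in neither piece. *)
Lemma conv_split D D' F a t : measurable D -> D `<=` `]-oo, a[ -> a <= t ->
  {ae mu, forall tau, (tau \in D') = (tau \in D) || (tau \in `]a, t[%classic)} ->
  conv_integrable D F a -> conv_integrable `]a, t[ F t ->
  conv_integrable D' F t /\
  conv D' F t = S (t - a) (conv D F a) + conv `]a, t[ F t.
Proof.
move=> mD Da at_ DD' iD iat.
have [iDt <-] : conv_integrable D F t /\ conv D F t = S (t - a) (conv D F a).
  by apply: conv_shift => // tau /Da; rewrite /= !in_itv/= => /ltW.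
move/bochner_integrableP: iDt => [v Dv]; move/bochner_integrableP: iat => [w atw].
have D'vw : is_bochner_integral mu setT (zext D' (fun tau => S (t - tau) (F tau))) (v + w).
  apply: (bint_ae_eq _ (bintD Dv atw)).
  apply: (ae_imply DD') => tau /=; rewrite /zext => ->.
  case: ifPn => [/set_mem/Da|_] /=; last by rewrite add0r.
  rewrite /= in_itv/= => taua; rewrite memNset ?addr0//.
  by rewrite /= in_itv/= ltNge (ltW taua).
split; first by apply/bochner_integrableP; exists (v + w).
by rewrite /conv (bochner_integralE D'vw) (bochner_integralE Dv) (bochner_integralE atw).
Qed.

Lemma conv_ae_eq D F G t : {ae mu, forall tau, D tau -> F tau = G tau} ->
  conv_integrable D F t -> conv D F t = conv D G t.
Proof.
move=> FG /bochner_integrableP[v Fv].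
rewrite /conv (bochner_integralE Fv); apply/esym/bochner_integralE.
apply: (bint_ae_eq _ Fv); apply: (ae_imply FG) => tau FGtau.
by rewrite /zext; case: ifPn => // /set_mem/FGtau ->.
Qed.

Lemma zext_reflect F t :
  zext `]-oo, t[ (fun tau => S (t - tau) (F tau)) =
  zext `]0, +oo[ (fun tau => S tau (F (t - tau))) \o (fun tau => t - tau).
Proof.
apply/funext => tau; rewrite /zext /= subKr.
by congr (if _ then _ else _); apply/idP/idP; rewrite !inE/= !in_itv/= andbT subr_gt0.
Qed.

Lemma zext_reflectV F t :
  zext `]0, +oo[ (fun tau => S tau (F (t - tau))) =
  zext `]-oo, t[ (fun tau => S (t - tau) (F tau)) \o (fun tau => t - tau).
Proof. by rewrite zext_reflect; apply/funext => tau /=; rewrite subKr. Qed.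

Lemma bint_reflect F t v :
  is_bochner_integral mu setT (zext `]0, +oo[ (fun tau => S tau (F (t - tau)))) v <->
  is_bochner_integral mu setT (zext `]-oo, t[ (fun tau => S (t - tau) (F tau))) v.
Proof.
have sphi (y : R) : exists x, t - x = y by exists (t - y); rewrite subKr.
split=> [|] iv.
  rewrite zext_reflect; apply: bint_comp iv => //; first exact: measurable_reflect.
  exact: lebesgue_measure_reflect.
rewrite zext_reflectV; apply: bint_comp iv => //; first exact: measurable_reflect.
exact: lebesgue_measure_reflect.
Qed.

Lemma global_solution_conv F t : global_solution S F t = conv `]-oo, t[ F t.
Proof.
rewrite /global_solution (bochner_integral_zext _ _ (measurable_itvR _)) /conv /bochner_integral.
by congr (xget _ _); apply/funext => v; apply/propext; exact: bint_reflect.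
Qed.

(** The constant [C / delta] is the integral of [C * expR (- delta * tau)] over positive times. The
    dominating function is written as [k] times the exponential density, whose total mass is 1. *)
Lemma conv_bounded_integrable F c t : 0 <= c -> strongly_measurable mu setT F ->
  {ae mu, forall tau, `|F tau| <= c} ->
  conv_integrable `]-oo, t[ F t /\ `|conv `]-oo, t[ F t| <= C / delta * c.
Proof.
move=> c0 sF Fc; pose k := C / delta * c.
have k0 : 0 <= k by rewrite mulr_ge0// divr_ge0// ltW.
have sg : strongly_measurable mu setT (zext `]0, +oo[ (fun tau => S tau (F (t - tau)))).
  rewrite zext_reflectV; apply: strongly_measurable_comp.
  - exact: measurable_reflect.
  - by move=> A mA A0; rewrite -[RHS]A0; exact: (lebesgue_measure_reflect t mA).
  - apply: strongly_measurable_conv; last exact: strongly_measurable_zext.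
    by move=> tau; rewrite /= !in_itv/= => /ltW.
have gk : {ae mu, forall tau, `|zext `]0, +oo[ (fun tau => S tau (F (t - tau))) tau| <=
    k * exponential_pdf delta tau}.
  have FcN : {ae mu, forall tau, `|F (t - tau)| <= c}.
    move: Fc => [N [mN N0 FN]]; exists ((fun tau => t - tau) @^-1` N); split.
    - by rewrite -[X in measurable X]setTI; exact: measurable_reflect.
    - by rewrite lebesgue_measure_reflect.
    - by move=> tau /= nP; exact: FN.
  apply: (ae_imply FcN) => tau Ftau; rewrite /zext; case: ifPn => [/set_mem|_]; last first.
    by rewrite normr0 mulr_ge0// exponential_pdf_ge0// ltW.
  rewrite /= in_itv/= andbT => tau0.
  rewrite exponential_pdfE ?(ltW tau0)// (le_trans (S_decay _ (ltW tau0)))//.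
  rewrite /k [leRHS](_ : _ = C * expR (- delta * tau) * c).
    by apply: ler_wpM2l => //; rewrite mulr_ge0 ?expR_ge0// ltW.
  rewrite !mulNr; field; exact: lt0r_neq0.
have ik : mu.-integrable setT (EFin \o (fun tau => k * exponential_pdf delta tau)).
  under [X in _.-integrable _ X]eq_fun do rewrite /= EFinM.
  by apply: integrableZl => //; exact: integrable_exponential_pdf.
have /bochner_integrableP[v gv] := bochner_integrable_dominated sg ik gk.
have hv := proj1 (bint_reflect F t v) gv.
split; first by apply/bochner_integrableP; exists v.
rewrite /conv (bochner_integralE hv) -lee_fin (le_trans (bint_norm_le gv))//.
apply: (@le_trans _ _ (\int[mu]_tau (k * exponential_pdf delta tau)%:E)%E).
  apply: ge0_ae_le_lower_integral => [tau|tau|].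
  - by rewrite lee_fin.
  - by rewrite lee_fin mulr_ge0// exponential_pdf_ge0// ltW.
  - by apply: (ae_imply gk) => tau; rewrite lee_fin.
under eq_integral do rewrite EFinM.
rewrite ge0_integralZl//.
- by rewrite integral_exponential_pdf// mule1.
- by apply/measurable_EFinP; exact: measurable_exponential_pdf.
- by move=> tau _; rewrite lee_fin exponential_pdf_ge0// ltW.
Qed.

Lemma conv_norm_le F c a t : 0 <= c -> a <= t -> {ae mu, forall tau, `|F tau| <= c} ->
  conv_integrable `]a, t[ F t -> `|conv `]a, t[ F t| <= C * c * (t - a).
Proof.
move=> c0 at_ Fc /bochner_integrableP[v Fv].
have k0 : 0 <= C * c by rewrite mulr_ge0// ltW.
rewrite /conv (bochner_integralE Fv) -lee_fin (le_trans (bint_norm_le Fv))//.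
apply: (@le_trans _ _ (\int[mu]_tau (C * c * \1_(`]a, t[%classic) tau)%:E)%E).
  apply: ge0_ae_le_lower_integral => [tau|tau|].
  - by rewrite lee_fin.
  - by rewrite lee_fin mulr_ge0.
  apply: (ae_imply Fc) => tau Ftau; rewrite lee_fin /zext indicE.
  case: ifPn => [/set_mem|_]; last by rewrite normr0 mulr0.
  rewrite /= in_itv/= mulr1 => /andP[_ taut].
  by apply: (le_trans (semigroup_norm_le _ _)); [rewrite subr_ge0 ltW|rewrite ler_pM2l].
under eq_integral do rewrite EFinM.
rewrite ge0_integralZl//; last exact/measurable_EFinP.
have -> : (\int[mu]_tau (\1_(`]a, t[%classic) tau)%:E = mu `]a, t[)%E by rewrite integral_indic// setIT.
rewrite lebesgue_measure_itv/= lte_fin.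
by case: ltP => // _; rewrite mule0 lee_fin mulr_ge0// subr_ge0.
Qed.

Lemma mild_solution_conv F U0 t :
  mild_solution S F U0 t = S t U0 + conv `]0, t[ F t.
Proof. by rewrite /mild_solution bochner_integral_zext. Qed.

Lemma global_solution_split F c a t : a <= t -> 0 <= c ->
  strongly_measurable mu setT F -> {ae mu, forall tau, `|F tau| <= c} ->
  conv_integrable `]a, t[ F t /\
  global_solution S F t = S (t - a) (global_solution S F a) + conv `]a, t[ F t.
Proof.
move=> at_ c0 sF Fc; rewrite !global_solution_conv.
have [ia _] := conv_bounded_integrable a c0 sF Fc.
have [it _] := conv_bounded_integrable t c0 sF Fc.
have iat : conv_integrable `]a, t[ F t.
  by apply: conv_integrableS it => // tau; rewrite /= !in_itv/= => /andP[].
split => //; apply: (proj2 (conv_split _ _ at_ _ ia iat)) => //.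
apply: (ae_imply (ae_neq a)) => tau taua.
apply/idP/idP; rewrite -!in_setU !inE /= !in_itv/=.
  by move=> taut; case: (ltgtP tau a) taua => // _ _; [left|right].
by case=> [ta|/andP[]//]; exact: lt_le_trans at_.
Qed.

Lemma bochner_integrable_itv F a t : (forall T, 0 < T -> bochner_integrable mu `]0, T[ F) ->
  0 <= a -> bochner_integrable mu setT (zext `]a, t[ F).
Proof.
(* [|t| + 1] is a positive horizon beyond [t], whatever the sign of [t]. *)
move=> iF a0; have T0 : 0 < `|t| + 1 by rewrite ltr_pwDr.
have := bochner_integrable_zext (measurable_itvR _) (iF _ T0).
apply: bochner_integrable_zextS => // tau; rewrite /= !in_itv/= => /andP[atau taut].
by rewrite (le_lt_trans a0)//= (lt_le_trans taut)// (le_trans (ler_norm _))// lerDl.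
Qed.

Lemma mild_solution_split F U0 a t : (forall T, 0 < T -> bochner_integrable mu `]0, T[ F) ->
  0 <= a -> a <= t ->
  mild_solution S F U0 t = S (t - a) (mild_solution S F U0 a) + conv `]a, t[ F t.
Proof.
move=> iF a0 at_; rewrite !mild_solution_conv.
have ta0 : 0 <= t - a by rewrite subr_ge0.
have ic (b s : R) : 0 <= b -> conv_integrable `]b, s[ F s.
  move=> b0; apply: conv_integrable_of_integrable; last exact: bochner_integrable_itv.
  by move=> tau; rewrite /= !in_itv/= => /andP[_ /ltW].
have D0a : `]0, a[ `<=` (`]-oo, a[ : set R).
  by move=> tau; rewrite /= !in_itv/= => /andP[].
have DD : {ae mu, forall tau, (tau \in `]0, t[%classic) =
    (tau \in `]0, a[%classic) || (tau \in `]a, t[%classic)}.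
  apply: (ae_imply (ae_neq a)) => tau taua.
  apply/idP/idP; rewrite -!in_setU !inE /= !in_itv/=.
    by move=> /andP[-> taut]; case: (ltgtP tau a) taua => // _ _; [left|right].
  case=> /andP[tau0 taut]; first by rewrite tau0 (lt_le_trans taut).
  by rewrite taut (le_lt_trans a0).
rewrite (proj2 (conv_split (measurable_itvR _) D0a at_ DD (ic 0 a (lexx _)) (ic a t a0))).
have [_ _ SD _] := S_semigroup.
by rewrite semigroupD// -SD// subrK addrA.
Qed.

Lemma expR_small (B e : R) : 0 <= B -> 0 < e -> exists2 s, 0 <= s &
  forall r, s <= r -> B * expR (- delta * r) <= e.
Proof.
(* This threshold comes from [1 + x <= expR x]: once [B <= e * delta * r], also
   [B <= e * expR (delta * r)]. *)
move=> B0 e0; exists (B / (e * delta)); first by rewrite divr_ge0 ?mulr_ge0 ?(ltW e0) ?(ltW delta0).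
move=> r; rewrite ler_pdivrMr ?mulr_gt0// => Br.
rewrite mulNr expRN ler_pdivrMr ?expR_gt0//.
apply: (@le_trans _ _ (e * (1 + delta * r))); last by rewrite ler_pM2l// expR_ge1Dx.
by rewrite mulrDr mulr1 (le_trans Br)// mulrC -mulrA lerDr ltW.
Qed.

(** * Implications between the five families of constants *)

Variables (Y : submodClosed X) (p : X -> R) (P : R).
Hypotheses (p_seminorm : seminorm p) (p_bounded : forall x, p x <= P * `|x|).

Lemma seminorm_ge0 x : 0 <= p x.
Proof.
have [pD pZ] := p_seminorm.
have p0 : p 0 = 0 by rewrite -(scale0r (0 : X)) pZ normr0 mul0r.
have := pD x (- x); rewrite subrr p0 -scaleN1r pZ normrN1 mul1r -mulr2n.
by rewrite pmulrn_lge0.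
Qed.

Lemma seminorm_sub x y : p x <= p y + p (x - y).
Proof. by have [+ _] := p_seminorm; move/(_ y (x - y)); rewrite addrC subrK. Qed.

Lemma Linfty_inP F : Linfty_in Y F ->
  exists2 c, 0 <= c & Linfty_norm setT F = c%:E /\ {ae mu, forall t, `|F t| <= c}.
Proof.
move=> [_ Foo _]; exists (fine (Linfty_norm setT F)).
  by rewrite fine_ge0// Linfty_norm_ge0.
have fin : Linfty_norm setT F \is a fin_num by rewrite ge0_fin_numE// Linfty_norm_ge0.
rewrite fineK//; split=> //.
have /(Linfty_norm_leP _ _ (Linfty_norm_ge0 _ _)) H := le_refl (Linfty_norm setT F).
by apply: (ae_imply H) => t /(_ I); rewrite -{1}(fineK fin) lee_fin.
Qed.

Lemma Linfty_norm_le F c : 0 <= c -> {ae mu, forall t, `|F t| <= c} ->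
  (Linfty_norm setT F <= c%:E)%E.
Proof.
move=> c0 Fc; apply/Linfty_norm_leP; first by rewrite lee_fin.
by apply: (ae_imply Fc) => t Ft _; rewrite lee_fin.
Qed.

Lemma bound_G0_bound_G K : bound_G0 S Y p K -> bound_G S Y p K.
Proof.
move=> [K0 GK]; split => // F FY; have [c c0 [-> Fc]] := Linfty_inP FY.
apply: ge_ereal_sup => _ [t _ <-].
have [sF _ Y_F] := FY.
pose G tau := F (t + tau).
have Gc : {ae mu, forall tau, `|G tau| <= c} := ae_shift t Fc.
have GY : Linfty_in Y G.
  split; last exact: (ae_shift t Y_F).
    apply: (strongly_measurable_comp (measurable_shift t) _ sF) => A mA A0.
    by rewrite -[RHS]A0; exact: lebesgue_measure_shift.
  by apply: le_lt_trans (Linfty_norm_le c0 Gc) _; rewrite ltry.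
have -> : global_solution S F t = global_solution S G 0.
  by congr bochner_integral; apply/funext => tau; rewrite /G sub0r.
apply: (le_trans (GK _ GY)).
by apply: lee_wpmul2l; [rewrite lee_fin|exact: Linfty_norm_le].
Qed.

Lemma bound_G_bound_P K : bound_G S Y p K -> bound_P S Y p K.
Proof. by move=> [K0 GK]; split => // F FY _; exact: GK. Qed.

Lemma bound_P_bound_P0 K : bound_P S Y p K -> bound_P0 S Y p K.
Proof.
move=> [K0 GK]; split => // F FY Fper.
by apply: le_trans (GK F FY Fper); apply: ereal_sup_ubound; exists 0.
Qed.

(** Makes the set of admissible constants nonempty, so that its infimum exists. [|P|] in place of
    [P] guarantees a nonnegative constant. *)
Lemma bound_G0_exists : bound_G0 S Y p (`|P| * (C / delta)).
Proof.
split; first by rewrite mulr_ge0// divr_ge0// ltW.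
move=> F FY; have [c c0 [-> Fc]] := Linfty_inP FY.
have [sF _ _] := FY; have [_ Bc] := conv_bounded_integrable 0 c0 sF Fc.
rewrite lee_fin global_solution_conv (le_trans (p_bounded _))//.
rewrite -mulrA; apply: (@le_trans _ _ (`|P| * `|conv `]-oo, 0[ F 0|)).
  by rewrite ler_wpM2r// ler_norm.
by rewrite ler_wpM2l.
Qed.

Lemma bound_G_bound_U K : bound_G S Y p K -> bound_U S Y p K.
Proof.
move=> [K0 GK]; split => // F U0 [iF YF] Foo.
have L0 : (0 <= ess_limsup F)%E by apply: ess_limsup_ge => T; exact: Linfty_norm_ge0.
have Lfin : ess_limsup F \is a fin_num by rewrite ge0_fin_numE.
rewrite -(fineK Lfin); set l := fine _.
have l0 : 0 <= l by exact: fine_ge0.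
apply/lee_addgt0Pr => e e0.
(* The error is [e1] from the homogeneous term and [K * e1] from the forcing exceeding its limsup
   [l] by [e1]; together they make [e]. *)
pose e1 := e / (K + 1).
have K10 : 0 < K + 1 by rewrite ltr_wpDl.
have e10 : 0 < e1 by rewrite divr_gt0.
have [T0 FT0] : exists T, (Linfty_norm `]T, +oo[ F < (l + e1)%:E)%E.
  by apply: ess_limsup_lt; rewrite -(fineK Lfin) lte_fin ltrDl.
pose T := Num.max 0 T0; have T_ge0 : 0 <= T by rewrite le_max lexx.
pose m := l + e1; have m0 : 0 <= m by rewrite addr_ge0// ltW.
have Fm : {ae mu, forall t, T < t -> `|F t| <= m}.
  have /(Linfty_norm_leP _ _ (_ : 0 <= m%:E)%E) := ltW FT0.
  rewrite lee_fin => /(_ m0) H; apply: (ae_imply H) => t + Tt; rewrite lee_fin; apply.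
  by rewrite /= in_itv/= andbT (le_lt_trans _ Tt)// le_max lexx orbT.
pose U1 := mild_solution S F U0 T.
have pconv t : T <= t -> p (conv `]T, t[ F t) <= K * m.
  (* Before [T] the forcing is merely integrable; cutting it there leaves a function bounded by [m].
     The extension by 0 stays in [Y] because [Y] contains 0, and the bound obtained does not depend
     on [t]. *)
  move=> Tt; pose G := zext `]T, t[ F.
  have Gm : {ae mu, forall tau, `|G tau| <= m}.
    apply: (ae_imply Fm) => tau Ftau; rewrite /G /zext; case: ifPn => [/set_mem|_].
      by rewrite /= in_itv/= => /andP[/Ftau].
    by rewrite normr0.
  have sG : strongly_measurable mu setT G.
    by apply: bochner_integrable_strongly_measurable; exact: bochner_integrable_itv.
  have GY : Linfty_in Y G.
    split => //; first by apply: le_lt_trans (Linfty_norm_le m0 Gm) _; rewrite ltry.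
    apply: (ae_imply YF) => tau Ytau; rewrite /G /zext; case: ifPn => [/set_mem|_].
      rewrite /= in_itv/= => /andP[Ttau _]; apply: Ytau; exact: le_lt_trans Ttau.
    exact: rpred0.
  have -> : conv `]T, t[ F t = global_solution S G t.
    rewrite global_solution_conv /conv; congr bochner_integral; apply/funext => tau.
    rewrite /G /zext; case: ifPn => [/[dup] Ttau|Ttau].
      by rewrite inE /= in_itv/= => /andP[_ taut]; rewrite mem_set//= in_itv.
    case: ifPn => // /set_mem; rewrite /= in_itv/= => taut.
    by rewrite semigroup0// subr_ge0 ltW.
  rewrite -lee_fin; apply: (@le_trans _ _ (K%:E * Linfty_norm setT G)%E); last first.
    by rewrite EFinM; apply: lee_wpmul2l; [rewrite lee_fin|exact: Linfty_norm_le].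
  by apply: le_trans (GK G GY); apply: ereal_sup_ubound; exists t.
have B0 : 0 <= `|P| * (C * `|U1|) by rewrite !mulr_ge0// ltW.
have [s s0 small] := expR_small B0 e10.
apply: (le_trans (ess_limsup_le _ (T + s))).
rewrite -EFinM -EFinD; apply/Linfty_norm_leP.
  by rewrite lee_fin addr_ge0 ?mulr_ge0// ltW.
apply: aeW => t; rewrite /= in_itv/= andbT => Tst.
have Tt : T <= t by rewrite (le_trans _ (ltW Tst))// lerDl.
rewrite lee_fin ger0_norm ?seminorm_ge0// (mild_solution_split U0 iF T_ge0 Tt).
have [pD _] := p_seminorm; apply: (le_trans (pD _ _)).
have tT0 : 0 <= t - T by rewrite subr_ge0.
have h : p (S (t - T) U1) <= e1.
  apply: (le_trans (p_bounded _)).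
  apply: (@le_trans _ _ (`|P| * (C * expR (- delta * (t - T)) * `|U1|))).
    apply: (@le_trans _ _ (`|P| * `|S (t - T) U1|)).
      by rewrite ler_wpM2r// ler_norm.
    by rewrite ler_wpM2l// S_decay.
  by rewrite mulrAC mulrA small// lerBrDl ltW.
apply: (le_trans (lerD h (pconv t Tt))).
rewrite /m mulrDr addrCA lerD2l -{1}(mul1r e1) -mulrDl [1 + K]addrC /e1.
by rewrite mulrC divfK ?lexx// lt0r_neq0.
Qed.

(** [F] is periodic only a.e., yet the conclusion holds at every [t]: reflection preserves null sets
    and the integral ignores them. *)
Lemma global_solution_periodic F T t : {ae mu, forall tau, F (tau + T) = F tau} ->
  global_solution S F (t + T) = global_solution S F t.
Proof.
move=> FT; apply: (bochner_integral_ae_eq (measurable_itvR _)).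
apply: (ae_imply (ae_reflect t FT)) => tau Ftau _.
by rewrite -Ftau addrAC.
Qed.

Lemma global_solution_periodicn F T n t : {ae mu, forall tau, F (tau + T) = F tau} ->
  global_solution S F (t + n%:R * T) = global_solution S F t.
Proof.
move=> FT; elim: n => [|n IHn]; first by rewrite mul0r addr0.
by rewrite -natr1 mulrDl mul1r addrA global_solution_periodic.
Qed.

Lemma bound_U_bound_P0 K : bound_U S Y p K -> bound_P0 S Y p K.
Proof.
move=> [K0 UK]; split => // F FY [T0 T00 Fper].
have [sF Foo YF] := FY; have [c c0 [Fc_eq Fc]] := Linfty_inP FY; rewrite Fc_eq.
pose U0 := global_solution S F 0.
have iF T : 0 < T -> bochner_integrable mu `]0, T[ F.
  move=> T_gt0; apply: (bochner_integrable_of_zext (measurable_itvR _)).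
  have i1 : mu.-integrable setT (EFin \o (fun tau => c * \1_(`]0, T[%classic) tau)).
    under [X in _.-integrable _ X]eq_fun do rewrite /= EFinM.
    by apply: integrableZl => //; exact: integrable_indic_itv.
  apply: (bochner_integrable_dominated _ i1); first exact: (strongly_measurable_zext (measurable_itvR _)).
  apply: (ae_imply Fc) => tau Ftau; rewrite /zext indicE.
  by case: ifPn => _; rewrite ?mulr1// normr0 mulr0.
have mildE t : 0 <= t -> mild_solution S F U0 t = global_solution S F t.
  move=> t0; have [_ ->] := global_solution_split t0 c0 sF Fc.
  by rewrite mild_solution_conv subr0.
have L1 : L1loc_in Y F by split => //; apply: (ae_imply YF) => t Yt _.
have Lc : (ess_limsup F <= c%:E)%E.
  by rewrite -Fc_eq; apply: (le_trans (ess_limsup_le F 0)); exact: Linfty_norm_nonincreasing.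
have := UK F U0 L1 (le_lt_trans Lc (ltry _)).
move=> /le_trans /(_ (lee_wpmul2l _ Lc)); rewrite lee_fin -EFinM => /(_ K0) mildK.
rewrite lee_fin; apply/ler_addgt0Pr => e e0.
have e20 : 0 < e / 2 by rewrite divr_gt0.
have [T mildT] : exists T, (Linfty_norm `]T, +oo[ (fun t => p (mild_solution S F U0 t))
    < (K * c + e / 2)%:E)%E.
  by apply: ess_limsup_lt; apply: le_lt_trans mildK _; rewrite lte_fin ltrDl.
have /(Linfty_norm_leP _ _ (_ : 0 <= (K * c + e / 2)%:E)%E) := ltW mildT.
rewrite lee_fin => /(_ (addr_ge0 (mulr_ge0 K0 c0) (ltW e20))) {}mildT.
have [eta eta0 cont] : exists2 eta, 0 < eta & forall s, 0 < s < eta ->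
    p (U0 - global_solution S F s) <= e / 2.
  (* Two errors of size [e'], one from the semigroup acting on [U0] and one from the forcing on []0,
     s[], cost at most [(|P| + 1) * (e' + e') = e / 2]. *)
  have Pc0 : 0 < 4 * (`|P| + 1) by rewrite mulr_gt0// ltr_wpDl.
  pose e' := e / (4 * (`|P| + 1)); have e'0 : 0 < e' by rewrite divr_gt0.
  have [_ S0 _ Scont] := S_semigroup.
  have /subspace_continuousP/(_ 0) := Scont U0; rewrite /= in_itv/= lexx => /(_ isT).
  move=> /cvgrPdist_lt /(_ e' e'0); rewrite nearE /within/= => /nbhs_ballP[r r0 rS].
  (* The radius [r] comes from strong continuity at [U0]; the other bound makes [C * c * s], the
     size of the forcing term, at most [e']. *)
  exists (Num.min r (e' / (C * c + 1))).
    by rewrite lt_min r0/= divr_gt0// ltr_wpDl// mulr_ge0// ltW.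
  move=> s /andP[s0]; rewrite lt_min => /andP[sr se].
  have [is_ ->] := global_solution_split (ltW s0) c0 sF Fc.
  rewrite subr0; set V := conv _ _ _; set W := S s _.
  have W_le : `|U0 - W| <= e'.
    apply: ltW; have := rS s; rewrite /ball/= sub0r normrN gtr0_norm// => /(_ sr).
    by rewrite /= in_itv/= (ltW s0) => /(_ isT); rewrite -[X in _ -> `|X - _| < _](S0 U0).
  have V_le : `|V| <= e'.
    apply: (le_trans (conv_norm_le c0 (ltW s0) Fc is_)); rewrite subr0.
    have k0 : 0 < C * c + 1 by rewrite ltr_wpDl// mulr_ge0// ltW.
    move: se; rewrite ltr_pdivlMr// => /ltW; apply: le_trans.
    by rewrite mulrC ler_pM2l// lerDl.
  apply: (le_trans (p_bounded _)).
  apply: (@le_trans _ _ (`|P| * (e' + e'))).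
    apply: (@le_trans _ _ (`|P| * `|U0 - (W + V)|)); first by rewrite ler_wpM2r// ler_norm.
    by rewrite ler_wpM2l// opprD addrA (le_trans (ler_normB _ _))// lerD.
  apply: (@le_trans _ _ ((`|P| + 1) * (e' + e'))).
    by rewrite ler_wpM2r ?lerDl// addr_ge0// ltW.
  suff -> : (`|P| + 1) * (e' + e') = e / 2 by [].
  by rewrite /e'; field; rewrite lt0r_neq0// ltr_wpDl.
(* After [n.+1] periods the time [T] has passed. A good instant [t] just after [n.+1%:R * T0] is
   brought back by periodicity to [s] in []0, eta[]. *)
pose n := Num.truncn (Num.max 0 T / T0).
have nT : Num.max 0 T < n.+1%:R * T0 by rewrite -ltr_pdivrMr// truncnS_gt.
have neta : n.+1%:R * T0 < n.+1%:R * T0 + eta by rewrite ltrDl.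
have [t /andP[nt tn] pt] := ae_exists_between neta mildT.
pose s := t - n.+1%:R * T0.
have ps : p (global_solution S F s) <= K * c + e / 2.
  rewrite -(global_solution_periodicn n.+1 s Fper) /s subrK -mildE; last first.
    by rewrite (le_trans _ (ltW nt))// mulr_ge0// ltW.
  have := pt; rewrite /= in_itv/= andbT lee_fin => /(_ _) pt'.
  apply: le_trans (pt' _); first exact: ler_norm.
  by rewrite (lt_trans _ nt)// (le_lt_trans _ nT)// le_max lexx orbT.
apply: (le_trans (seminorm_sub _ (global_solution S F s))).
have -> : K * c + e = K * c + e / 2 + e / 2 by field.
apply: lerD => //; apply: cont.
by rewrite /s subr_gt0 nt/= ltrBlDl.
Qed.

Lemma bound_P0_bound_G0 K : bound_P0 S Y p K -> bound_G0 S Y p K.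
Proof.
move=> [K0 PK]; split => // F FY; have [c c0 [-> Fc]] := Linfty_inP FY.
have [sF _ YF] := FY; rewrite -EFinM lee_fin; apply/ler_addgt0Pr => e e0.
(* [B] bounds both solutions, with forcing [F] and with its periodic copy, at time [- q]. Their
   difference there has norm at most [B + B] and reaches time 0 through [S q]. *)
pose B := C / delta * c; have B0 : 0 <= B by rewrite mulr_ge0// divr_ge0// ltW.
have B'0 : 0 <= `|P| * (C * (B + B)) by rewrite !mulr_ge0 ?addr_ge0// ltW.
have [s s0 small] := expR_small B'0 e0.
have [q q0 sq] : exists2 q, 0 < q & s <= q by exists (s + 1); rewrite ?ltr_wpDl ?lerDl.
pose G := F \o wrap q.
have Gc : {ae mu, forall tau, `|G tau| <= c} := ae_wrap q0 Fc.
have sG : strongly_measurable mu setT G.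
  apply: (strongly_measurable_comp (measurable_wrap q0) _ sF) => D mD D0.
  exact: wrap_null.
have GY : Linfty_in Y G.
  split => //; last exact: (ae_wrap q0 YF).
  by apply: le_lt_trans (Linfty_norm_le c0 Gc) _; rewrite ltry.
have Gper : ae_periodic G.
  by exists q => //; apply: aeW => t; rewrite /G /= wrap_periodic.
have pG : p (global_solution S G 0) <= K * c.
  rewrite -lee_fin; apply: (le_trans (PK _ GY Gper)).
  by rewrite EFinM; apply: lee_wpmul2l; [rewrite lee_fin|exact: Linfty_norm_le].
have Nq0 : - q <= 0 by rewrite oppr_le0 ltW.
have [iF Fsplit] := global_solution_split Nq0 c0 sF Fc.
have [_ Gsplit] := global_solution_split Nq0 c0 sG Gc.
have FG : conv `]- q, 0[ F 0 = conv `]- q, 0[ G 0.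
  apply: conv_ae_eq iF; apply: aeW => tau; rewrite /= in_itv/= => tauq.
  by rewrite /G /= wrapE.
apply: (le_trans (seminorm_sub _ (global_solution S G 0))).
apply: (lerD pG); rewrite {}Fsplit {}Gsplit {}FG.
have addrBK (x y z : X) : x + z - (y + z) = x - y by rewrite opprD addrACA subrr addr0.
rewrite sub0r opprK addrBK -(semigroupB _ _ (ltW q0)).
apply: (le_trans (p_bounded _)); set V := _ - _.
have V_le : `|V| <= B + B.
  rewrite /V (le_trans (ler_normB _ _))// !global_solution_conv lerD//.
    by have [] := conv_bounded_integrable (- q) c0 sF Fc.
  by have [] := conv_bounded_integrable (- q) c0 sG Gc.
apply: (@le_trans _ _ (`|P| * `|S q V|)); first by rewrite ler_wpM2r// ler_norm.
apply: (le_trans _ (small q sq)).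
rewrite -mulrA ler_wpM2l//; apply: (le_trans (S_decay _ (ltW q0))).
by rewrite mulrAC ler_wpM2r ?expR_ge0// ler_wpM2l// ltW.
Qed.

Lemma is_OB_G0_exists : exists K, is_OB_G0 S Y p K.
Proof.
pose I : set R := [set K : R | bound_G0 S Y p K].
have I0 : I !=set0 by exists (`|P| * (C / delta)); exact: bound_G0_exists.
have lbI : lbound I 0 by move=> K [].
have hI : has_inf I by split => //; exists 0.
exists (inf I); split; last by move=> K IK; apply: ge_inf => //; exists 0.
have I_ge0 : 0 <= inf I by exact: lb_le_inf.
split => // F FY; have [c c0 [Fc_eq _]] := Linfty_inP FY.
rewrite Fc_eq -EFinM lee_fin; apply/ler_addgt0Pr => e e0.
(* The slack is divided by [c + 1] because [c] may be 0. *)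
have e10 : 0 < e / (c + 1) by rewrite divr_gt0// ltr_wpDl.
have [K [_ GK] KI] := inf_adherent e10 hI.
have := GK F FY; rewrite Fc_eq -EFinM lee_fin => /le_trans; apply.
apply: (@le_trans _ _ ((inf I + e / (c + 1)) * c)); first by rewrite ler_wpM2r// ltW.
rewrite mulrDl lerD2l -mulrAC ler_pdivrMr ?ltr_wpDl// ler_pM2l//.
by rewrite lerDl.
Qed.

End semigroup_convolution.

Theorem theorem2p2 (R : realType) (X : completeNormedModType R)
  (Y : submodClosed X)
  (p : X -> R) (p_seminorm : seminorm p)
  (p_bounded : exists P : R, forall x, p x <= P * `|x|)
  (domA : set X) (A : X -> X) (S : R -> X -> X)
  (S_semigroup : associated_semigroup domA A S)
  (S_decay : exists C delta : R, [/\ 0 < C, 0 < delta &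
     forall (t : R) (x : X), 0 <= t -> `|S t x| <= C * expR (- delta * t) * `|x|]) :
  exists OB : R,
    [/\ is_OB_U S Y p OB, is_OB_G S Y p OB, is_OB_G0 S Y p OB,
        is_OB_P S Y p OB & is_OB_P0 S Y p OB].
Proof.
have [P p_le] := p_bounded; have [C [delta [C0 d0 decay]]] := S_decay.
have [Sg _] := S_semigroup.
have [OB OB_G0] := is_OB_G0_exists C0 d0 Sg decay Y p_le.
(* The implications form the cycle G0, G, P, P0, G0, with the detour G, U, P0. Admissibility of [OB]
   travels forward from G0, its minimality is pulled back along the way to G0. *)
have G0_G K : bound_G0 S Y p K -> bound_G S Y p K by exact: bound_G0_bound_G.
have G_P K : bound_G S Y p K -> bound_P S Y p K by exact: bound_G_bound_P.
have P_P0 K : bound_P S Y p K -> bound_P0 S Y p K by exact: bound_P_bound_P0.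
have P0_G0 K : bound_P0 S Y p K -> bound_G0 S Y p K.
  by exact: (bound_P0_bound_G0 C0 d0 Sg decay p_seminorm p_le).
have G_U K : bound_G S Y p K -> bound_U S Y p K.
  by exact: (bound_G_bound_U C0 d0 Sg decay p_seminorm p_le).
have U_P0 K : bound_U S Y p K -> bound_P0 S Y p K.
  by exact: (bound_U_bound_P0 C0 d0 Sg decay p_seminorm p_le).
have [G0_OB OB_min] := OB_G0.
exists OB; split=> //; split.
- exact/G_U/G0_G.
- by move=> K /U_P0/P0_G0/OB_min.
- exact: G0_G.
- by move=> K /G_P/P_P0/P0_G0/OB_min.
- exact/G_P/G0_G.
- by move=> K /P_P0/P0_G0/OB_min.
- exact/P_P0/G_P/G0_G.
- by move=> K /P0_G0/OB_min.
Qed.
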